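(* Let $p$ be an odd prime. Let $d$ and $c$ be positive integers which are coprime to each other and both coprime to $p$. Let $R$ be a nontrivial complete non-Archimedean normed commutative $\mathbb{Q}_p$-algebra without zero divisors. Let $m$ be a positive integer and let $\chi : (\mathbb{Z}/dp^m\mathbb{Z})^\times \to R^\times$ be a Dirichlet character of level $dp^m$ which is even (i.e. $\chi(-1)=1$) and whose conductor is divisible by $d$. For a continuous monoid homomorphism $w : (\mathbb{Z}/d\mathbb{Z})^\times \times \mathbb{Z}_p^\times \to R$, let $$L_p(w,\chi) := \int_{(\mathbb{Z}/d\mathbb{Z})^\times \times \mathbb{Z}_p^\times} \chi\omega^{-1}(a)\, w(a)\, dE_c \in R$$ be the $p$-adic $L$-function, where $E_c$ is the Bernoulli measure. For an integer $k \ge 0$ let $w_k : (\mathbb{Z}/d\mathbb{Z})^\times \times \mathbb{Z}_p^\times \to R$ be the continuous monoid homomorphism $w_k(a_1,a_2) = \langle a_2\rangle^k = (\omega^{-1}(a_2)\,a_2)^k$. Then for every integer $n>1$, $$L_p(w_{n-1},\chi) = \frac{1}{n}\,\bigl(1-\chi(c)\langle c\rangle^{n}\bigr)\,\bigl(1-\chi\omega^{-n}(p)\,p^{n-1}\bigr)\,B_{n,\chi\omega^{-n}}.$$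
   Context: Algebras: a non-Archimedean normed commutative $\mathbb{Q}_p$-algebra $R$ is a commutative normed ring which is a normed $\mathbb{Q}_p$-algebra and whose norm satisfies $\|x+y\|\le\max(\|x\|,\|y\|)$. Elements of $\mathbb{Z}$, $\mathbb{Q}$, $\mathbb{Z}_p$ and $\mathbb{Q}_p$ are regarded as elements of $R$ via the structure map $\mathbb{Q}_p\to R$. Dirichlet characters: a Dirichlet character of level $N$ with values in $R$ is a homomorphism $\psi:(\mathbb{Z}/N\mathbb{Z})^\times\to R^\times$. Its conductor is the least $f\mid N$ such that $\psi$ factors through $(\mathbb{Z}/N\mathbb{Z})^\times\to(\mathbb{Z}/f\mathbb{Z})^\times$; the induced character of level $f$ is the primitive character associated to $\psi$. A character of level $N$ is evaluated at integers by $\psi(a)=\psi(a \bmod N)$ if $\gcd(a,N)=1$ and $\psi(a)=0$ otherwise. The product $\psi_1\psi_2$ of characters of levels $N_1,N_2$ is the primitive character associated to the pointwise product of the two characters inflated to level $\mathrm{lcm}(N_1,N_2)$. Teichmüller character: $\omega:(\mathbb{Z}/p\mathbb{Z})^\times\to\mathbb{Z}_p^\times$ sends $x$ to the unique $(p-1)$-th root of unity congruent to $x$ modulo $p$; it is also viewed as an $R^\times$-valued Dirichlet character of level $p$, and as a function on $\mathbb{Z}_p^\times$ (and on integers prime to $p$) by reduction mod $p$. For such $a$, $\langle a\rangle=\omega^{-1}(a)a$. For $k\ge1$, $\chi\omega^{-k}$ denotes the product of $\chi$ and the level $p$ character $\omega^{-k}$, i.e. the primitive character associated to the pointwise product of $\chi$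 and $\omega^{-k}$ inflated to level $\mathrm{lcm}(dp^m,p)=dp^m$. In the integral defining $L_p(w,\chi)$, $\chi\omega^{-1}(a)$ for $a=(a_1,a_2)\in(\mathbb{Z}/d\mathbb{Z})^\times\times\mathbb{Z}_p^\times$ denotes the value of $\chi\omega^{-1}$, inflated to level $dp^m$, at the unit of $\mathbb{Z}/dp^m\mathbb{Z}$ congruent to $a_1$ mod $d$ and to $a_2$ mod $p^m$. Generalized Bernoulli numbers: the Bernoulli polynomials $B_n(X)\in\mathbb{Q}[X]$ are defined by $\sum_{n\ge0}B_n(X)\frac{t^n}{n!}=\frac{te^{tX}}{e^t-1}$. For a character $\psi$ of conductor $f$ with associated primitive character $\psi_0$ of level $f$, $$B_{n,\psi}=f^{\,n-1}\sum_{a=1}^{f}\psi_0(a)\,B_n\!\left(\frac{a}{f}\right).$$ Bernoulli measure: for $n\ge 0$ and $a\in\mathbb{Z}/dp^n\mathbb{Z}$ (identified with its representative in $\{0,\dots,dp^n-1\}$), put $$E_{c,n}(a)=\left\{\frac{a}{dp^{n}}\right\}-c\left\{\frac{c^{-1}a}{dp^{n}}\right\}+\frac{c-1}{2},$$ where $\{x\}$ is the fractional part of $x$ and $c^{-1}$ is an integer with $cc^{-1}\equiv1 \pmod{dp^{2n+1}}$. For a locally constant function $f:(\mathbb{Z}/d\mathbb{Z})^\times\times\mathbb{Z}_p^\times\to R$, extend $f$ by zero to a locally constant function on $\mathbb{Z}/d\mathbb{Z}\times\mathbb{Z}_p$ and define $$\int f\,dE_c = E_c(f)=\lim_{n\to\infty}\sum_{a\in\mathbb{Z}/dp^n\mathbb{Z}}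 f(a)\,E_{c,n}(a),$$ where $f(a)$ is the value at the image in $\mathbb{Z}/d\mathbb{Z}\times\mathbb{Z}_p$ of the representative of $a$; this sequence is eventually constant in $n$. The map $E_c$ is $R$-linear and bounded for the sup norm, i.e. it is a measure. For continuous $f$, $\int f\,dE_c$ is the value at $f$ of the unique continuous extension of $E_c$ from locally constant functions to the space $C((\mathbb{Z}/d\mathbb{Z})^\times\times\mathbb{Z}_p^\times,R)$ with the sup norm, in which locally constant functions are dense. *)

(* Defs.v *)
From HB Require Import structures.
From mathcomp Require Import all_boot all_order all_algebra all_fingroup cyclic.
From mathcomp Require Import generic_quotient ring.
From mathcomp Require Import all_classical reals topology.

Set Implicit Arguments.
Unset Strict Implicit.
Unset Printing Implicit Defensive.

Import Order.TTheory GRing.Theory Num.Theory.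

Local Open Scope classical_set_scope.
Local Open Scope ring_scope.

(** * The ring of p-adic integers, as the inverse limit of the Z/p^n *)

(* [zmod x n] is the representative of x mod p^n in {0, ..., p^n - 1}. *)
Record padicInt (p : nat) (p_pr : prime p) := PadicInt {
  zmod : nat -> nat;
  zmod_coherent : forall n, (zmod n.+1 %% p ^ n)%N = zmod n }.

Section PadicIntRing.
Variables (p : nat) (p_pr : prime p).
Notation Zp := (padicInt p_pr).
Implicit Types x y z : Zp.

HB.instance Definition _ := gen_eqMixin Zp.
HB.instance Definition _ := gen_choiceMixin Zp.

Lemma padicInt_eq x y : zmod x =1 zmod y -> x = y.
Proof.
case: x y => [f cf] [g cg] /= /funext fg; rewrite fg in cf *.
by congr PadicInt; exact: Prop_irrelevance.
Qed.

Let pn_gt0 n : (0 < p ^ n)%N. Proof. by rewrite expn_gt0 prime_gt0. Qed.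

Lemma zmod_lt x n : (zmod x n < p ^ n)%N.
Proof. by rewrite -(zmod_coherent x n) ltn_mod. Qed.

Lemma zmod_small x n : (zmod x n %% p ^ n)%N = zmod x n.
Proof. by rewrite modn_small ?zmod_lt. Qed.

Definition coherent (f : nat -> nat) := forall n, f n.+1 = f n %[mod p ^ n].

Lemma zmodS x : coherent (zmod x).
Proof. by move=> n; rewrite zmod_coherent zmod_small. Qed.

Lemma coherent_mod f : coherent f ->
  forall n, ((f n.+1 %% p ^ n.+1) %% p ^ n)%N = (f n %% p ^ n)%N.
Proof. by move=> cf n; rewrite modn_dvdm ?dvdn_exp2l// cf. Qed.

Definition mkPadicInt f (cf : coherent f) : Zp :=
  PadicInt p_pr (coherent_mod cf).

Let cst_coherent k : coherent (fun=> k). Proof. by []. Qed.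

Let add_coherent x y : coherent (fun n => zmod x n + zmod y n)%N.
Proof. by move=> n; rewrite -modnDm !zmodS modnDm. Qed.

Let mul_coherent x y : coherent (fun n => zmod x n * zmod y n)%N.
Proof. by move=> n; rewrite -modnMm !zmodS modnMm. Qed.

Let opp_coherent x : coherent (fun n => p ^ n - zmod x n)%N.
Proof.
move=> n; apply/eqP; rewrite -(eqn_modDr (zmod x n.+1)) subnK 1?ltnW ?zmod_lt//.
rewrite -[X in _ == X]modnDmr zmodS modnDmr subnK 1?ltnW ?zmod_lt//.
by rewrite modnn expnS modnMl.
Qed.

Definition zp0 := mkPadicInt (cst_coherent 0).
Definition zp1 := mkPadicInt (cst_coherent 1).
Definition zpadd x y := mkPadicInt (add_coherent x y).
Definition zpmul x y := mkPadicInt (mul_coherent x y).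
Definition zpopp x := mkPadicInt (opp_coherent x).

Let zpaddA : associative zpadd.
Proof. by move=> x y z; apply: padicInt_eq => n /=; rewrite modnDml modnDmr addnA. Qed.
Let zpaddC : commutative zpadd.
Proof. by move=> x y; apply: padicInt_eq => n /=; rewrite addnC. Qed.
Let zpadd0 : left_id zp0 zpadd.
Proof. by move=> x; apply: padicInt_eq => n /=; rewrite mod0n add0n zmod_small. Qed.
Let zpaddN : left_inverse zp0 zpopp zpadd.
Proof.
move=> x; apply: padicInt_eq => n /=.
by rewrite modnDml subnK 1?ltnW ?zmod_lt// modnn mod0n.
Qed.

HB.instance Definition _ :=
  GRing.isZmodule.Build Zp zpaddA zpaddC zpadd0 zpaddN.

Let zpmulA : associative zpmul.
Proof. by move=> x y z; apply: padicInt_eq => n /=; rewrite modnMml modnMmr mulnA. Qed.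
Let zpmulC : commutative zpmul.
Proof. by move=> x y; apply: padicInt_eq => n /=; rewrite mulnC. Qed.
Let zpmul1 : left_id zp1 zpmul.
Proof. by move=> x; apply: padicInt_eq => n /=; rewrite modnMml mul1n zmod_small. Qed.
Let zpmulDl : left_distributive zpmul zpadd.
Proof.
by move=> x y z; apply: padicInt_eq => n /=; rewrite modnMml modnDm mulnDl.
Qed.
Let zp1_neq0 : zp1 != zp0.
Proof.
apply/eqP => /(congr1 (fun x => zmod x 1)) /=.
by rewrite expn1 mod0n modn_small ?prime_gt1.
Qed.

HB.instance Definition _ :=
  GRing.Zmodule_isComNzRing.Build Zp zpmulA zpmulC zpmul1 zpmulDl zp1_neq0.

Lemma zmod0 n : zmod (0 : Zp) n = 0%N. Proof. exact: mod0n. Qed.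
Lemma zmod1 n : zmod (1 : Zp) n = (1 %% p ^ n)%N. Proof. by []. Qed.
Lemma zmodD x y n : zmod (x + y) n = ((zmod x n + zmod y n) %% p ^ n)%N.
Proof. by []. Qed.
Lemma zmodM x y n : zmod (x * y) n = ((zmod x n * zmod y n) %% p ^ n)%N.
Proof. by []. Qed.

Lemma zmod_le x m n : (m <= n)%N -> (zmod x n %% p ^ m)%N = zmod x m.
Proof.
move=> /subnK <-; elim: (n - m)%N => [|k IH]; first by rewrite zmod_small.
by rewrite -(@modn_dvdm (p ^ (k + m))) ?dvdn_exp2l ?leq_addl// zmod_coherent.
Qed.

Lemma zmod_coprime x n : zmod x 1 != 0%N -> coprime (zmod x n) (p ^ n).
Proof.
move=> x1; case: n => [|n]; first by rewrite coprimen1.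
rewrite coprimeXr// coprime_sym prime_coprime//; apply: contra x1.
by rewrite -(zmod_le x (ltn0Sn n)).
Qed.

Let inv_coherent x : zmod x 1 != 0%N ->
  coherent (fun n => zmod x n ^ (totient (p ^ n)).-1)%N.
Proof.
move=> x1 n; set M := (p ^ n)%N.
have eul k : (zmod x k * zmod x k ^ (totient (p ^ k)).-1 = 1 %[mod p ^ k])%N.
  rewrite -expnS prednK ?totient_gt0//.
  exact/Euler_exp_totient/zmod_coprime.
set u := (zmod x n.+1 ^ _)%N; set v := (zmod x n ^ _)%N.
have hv : (zmod x n * v = 1 %[mod M])%N := eul n.
have hu : (zmod x n * u = 1 %[mod M])%N.
  rewrite -modnMml -zmodS modnMml -(@modn_dvdm (p ^ n.+1)) ?dvdn_exp2l//.
  by rewrite eul modn_dvdm ?dvdn_exp2l.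
have -> : (u %% M = u * (zmod x n * v) %% M)%N.
  by rewrite -modnMmr hv modnMmr muln1.
by rewrite mulnA (mulnC u) -modnMml hu modnMml mul1n.
Qed.

Definition zpunit : {pred Zp} := fun x => zmod x 1 != 0%N.
Definition zpinv x : Zp :=
  if pselect (zpunit x) is left x1 then mkPadicInt (inv_coherent x1) else x.

Let zpmulV : {in zpunit, left_inverse 1 zpinv *%R}.
Proof.
move=> x; rewrite /in_mem /= /zpinv => x1; case: pselect => [x1'|//].
apply: padicInt_eq => n; rewrite zmodM zmod1 /= modnMml mulnC -expnS.
by rewrite prednK ?totient_gt0//; exact/Euler_exp_totient/zmod_coprime.
Qed.

Let zpunitPl x y : y * x = 1 -> zpunit x.
Proof.
move=> /(congr1 (fun z : Zp => zmod z 1)); rewrite zmodM zmod1 /zpunit.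
by case: eqP => // ->; rewrite muln0 mod0n modn_small ?expn1 ?prime_gt1.
Qed.

Let zpinv_out : {in [predC zpunit], zpinv =1 id}.
Proof.
by move=> x /negP xN; rewrite /zpinv; case: pselect.
Qed.

HB.instance Definition _ :=
  GRing.ComNzRing_hasMulInverse.Build Zp zpmulV zpunitPl zpinv_out.

Let zpdom : GRing.integral_domain_axiom Zp.
Proof.
move=> x y xy0; apply/norP => -[x0 y0].
have ex z : z != 0 -> exists n, zmod z n != 0%N.
  move=> z0; apply: contrapT => H; move/eqP: z0; apply; apply: padicInt_eq => n.
  by rewrite zmod0; apply: contrapT => zn; apply: H; exists n; apply/eqP.
have [[m xm] [n yn]] := (ex _ x0, ex _ y0).
have ndvd z k N : zmod z k != 0%N -> (k <= N)%N -> ~~ (p ^ k %| zmod z N)%N.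
  by move=> zk kN; rewrite /dvdn zmod_le.
have gt0 z k N : zmod z k != 0%N -> (k <= N)%N -> (0 < zmod z N)%N.
  by move=> zk kN; have := ndvd _ _ _ zk kN; case: (zmod z N); rewrite ?dvdn0.
have xN := ndvd _ _ (m + n)%N xm (leq_addr _ _).
have yN := ndvd _ _ (m + n)%N yn (leq_addl _ _).
have x_gt0 := gt0 _ _ (m + n)%N xm (leq_addr _ _).
have y_gt0 := gt0 _ _ (m + n)%N yn (leq_addl _ _).
have := congr1 (fun z : Zp => zmod z (m + n)) xy0.
rewrite zmodM zmod0 => /eqP; rewrite -/(dvdn _ _).
move: xN yN; rewrite !pfactor_dvdn ?muln_gt0 ?x_gt0 ?y_gt0// lognM//.
by rewrite -!ltnNge => lx ly; apply/negP; rewrite -ltnNge -addSn leq_add// ltnW.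
Qed.

HB.instance Definition _ := GRing.ComUnitRing_isIntegral.Build Zp zpdom.

(* The profinite topology: Zp is a subspace of the product of the discrete
   spaces of residues. *)
HB.instance Definition _ := Topological.copy Zp
  (initial_topology (@zmod p p_pr : Zp -> {ptws nat -> nat})).

End PadicIntRing.

(** * The field of p-adic numbers and its absolute value *)

Notation padicNum p_pr := {fraction (padicInt p_pr)}.

Section PadicNorm.
Variables (p : nat) (p_pr : prime p) (K : realType).

(* If n is least such that x <> 0 mod p^n, then x has valuation n - 1. *)
Definition padicInt_abs (x : padicInt p_pr) : K :=
  if pselect (exists n, zmod x n != 0%N) is left ex_n
  then p%:R ^- (ex_minn ex_n).-1 else 0.

Definition padic_abs (x : padicNum p_pr) : K :=
  padicInt_abs \n_(repr x) / padicInt_abs \d_(repr x).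

End PadicNorm.

(** * Complete non-Archimedean normed commutative Qp-algebras *)

(* A new norm is needed because [Num.norm] satisfies |x *+ n| = |x| *+ n, which
   fails for non-Archimedean norms. *)
HB.mixin Record isNonArchNormed (K : realType) (p : nat) (p_pr : prime p) R
    of Metric K R & GRing.ComAlgebra (padicNum p_pr) R := {
  nnorm : R -> K;
  nnorm_ge0 : forall x, 0 <= nnorm x;
  nnorm_eq0 : forall x, nnorm x = 0 <-> x = 0;
  nnormD_max : forall x y : R, nnorm (x + y) <= Num.max (nnorm x) (nnorm y);
  nnormM_le : forall x y : R, nnorm (x * y) <= nnorm x * nnorm y;
  nnormZ : forall (a : padicNum p_pr) (x : R), nnorm (a *: x) = padic_abs K a * nnorm x;
  mdist_nnorm : forall x y : R, mdist x y = nnorm (x - y) }.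

#[short(type="completeNonArchAlgType")]
HB.structure Definition CompleteNonArchAlg (K : realType) (p : nat)
    (p_pr : prime p) :=
  { R of Metric K R & Complete R & GRing.ComAlgebra (padicNum p_pr) R
       & isNonArchNormed K p p_pr R }.

(** * Dirichlet characters *)

(* (Z/N)^* is {unit 'Z_N}.  Since 'Z_1 is Z/2, for N = 1 this is the group
   (Z/2)^*, which is trivial as (Z/1)^* should be. *)
Definition toUnit (N : nat) (a : int) : {unit 'Z_N} := 
  insubd (1%g : {unit 'Z_N}) (a%:~R : 'Z_N).

Definition unitRed (N M : nat) (u : {unit 'Z_N}) : {unit 'Z_M} :=
  toUnit M (val u : nat).

Section Dirichlet.
Variable R : comNzRingType.

(* A monoid homomorphism from the group (Z/N)^* to R takes values in R^*. *)
Definition is_dirichlet (N : nat) (psi : {unit 'Z_N} -> R) : Prop :=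
  psi 1%g = 1 /\ {morph psi : u v / (u * v)%g >-> u * v}.

Definition dir_eval (N : nat) (psi : {unit 'Z_N} -> R) (a : int) : R :=
  if coprimez a N then psi (toUnit N a) else 0.

Definition factors_through (N : nat) (psi : {unit 'Z_N} -> R) (f : nat) : Prop :=
  exists phi : {unit 'Z_f} -> R, psi = phi \o unitRed f.

Lemma ex_conductor (N : nat) (psi : {unit 'Z_N} -> R) :
  exists f, (f %| N)%N && `[< factors_through psi f >].
Proof.
exists N; rewrite dvdnn; apply/asboolP; exists psi; apply/funext => u /=.
congr psi; apply: val_inj; rewrite /unitRed /toUnit -pmulrn natr_Zp.
by rewrite insubdK// (valP u).
Qed.

Definition conductor (N : nat) (psi : {unit 'Z_N} -> R) : nat :=
  ex_minn (ex_conductor psi).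

Lemma conductor_factors (N : nat) (psi : {unit 'Z_N} -> R) :
  factors_through psi (conductor psi).
Proof. by rewrite /conductor; case: ex_minnP => f /andP[_ /asboolP]. Qed.

Definition primitive (N : nat) (psi : {unit 'Z_N} -> R) :
    {unit 'Z_(conductor psi)} -> R :=
  projT1 (cid (conductor_factors psi)).
Arguments primitive {N} psi _.

Definition inflate (N M : nat) (psi : {unit 'Z_N} -> R) : {unit 'Z_M} -> R :=
  psi \o unitRed N.
Arguments inflate {N} M psi _.

Definition dir_mul_lcm (N1 N2 : nat) (psi1 : {unit 'Z_N1} -> R)
    (psi2 : {unit 'Z_N2} -> R) : {unit 'Z_(lcmn N1 N2)} -> R :=
  fun u => inflate _ psi1 u * inflate _ psi2 u.

Definition dir_mul (N1 N2 : nat) (psi1 : {unit 'Z_N1} -> R)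
    (psi2 : {unit 'Z_N2} -> R) :
    {unit 'Z_(conductor (dir_mul_lcm psi1 psi2))} -> R :=
  primitive (dir_mul_lcm psi1 psi2).

End Dirichlet.
Arguments primitive {R N} psi _.
Arguments inflate {R N} M psi _.
Arguments dir_mul_lcm {R N1 N2} psi1 psi2 _.
Arguments dir_mul {R N1 N2} psi1 psi2 _.

(** * Bernoulli polynomials *)

(* The list [:: B_0; ...; B_(n-1)]. *)
Fixpoint bern_polys (n : nat) : seq {poly rat} :=
  if n is k.+1 then
    rcons (bern_polys k)
      ('X^k - k.+1%:R^-1 *: \sum_(i < k) ('C(k.+1, i))%:R *: (bern_polys k)`_i)
  else [::].

Definition bern_poly (n : nat) : {poly rat} := (bern_polys n.+1)`_n.

Lemma size_bern_polys n : size (bern_polys n) = n.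
Proof. by elim: n => //= n IH; rewrite size_rcons IH. Qed.

Lemma bern_polys_nth n i : (i < n)%N -> (bern_polys n)`_i = bern_poly i.
Proof.
elim: n => // n IH; rewrite ltnS leq_eqVlt => /predU1P[->//|lin] /=.
by rewrite nth_rcons size_bern_polys lin IH.
Qed.

(* The generating series sum_n B_n(X) t^n / n! is characterised by its product
   with e^t - 1 being t e^(tX); we compare the coefficients of t^n. *)
Lemma bern_poly_series (n : nat) :
  \sum_(k < n.+1) (if (k < n)%N then (n - k)`!%:R^-1 else 0) *:
                    (k`!%:R^-1 *: bern_poly k) =
  if n is m.+1 then m`!%:R^-1 *: 'X^m else 0 :> {poly rat}.
Proof.
rewrite big_ord_recr /= ltnn scale0r addr0.
case: n => [|m]; first by rewrite big_ord0.
have fac_neq0 k : k`!%:R != 0 :> rat by rewrite pnatr_eq0 -lt0n fact_gt0.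
have rec : \sum_(i < m.+1) ('C(m.+1, i))%:R *: bern_poly i = m.+1%:R *: 'X^m.
  rewrite big_ord_recr /= {2}/bern_poly /= nth_rcons size_bern_polys ltnn eqxx.
  have -> : ('C(m.+1, m))%:R = m.+1%:R :> rat by rewrite binSn.
  rewrite scalerBr scalerA divff ?pnatr_eq0// scale1r addrCA.
  under eq_bigr => i _ do rewrite -(bern_polys_nth (ltn_ord i)).
  by rewrite subrr addr0.
transitivity (m.+1`!%:R^-1 *: \sum_(i < m.+1) ('C(m.+1, i))%:R *: bern_poly i).
  rewrite scaler_sumr; apply: eq_bigr => i _; rewrite ltn_ord !scalerA.
  congr (_ *: _); rewrite -(bin_fact (ltnW (ltn_ord i))) !natrM.
  field; rewrite !fac_neq0 /= pnatr_eq0 -lt0n bin_gt0 ltnW//.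
rewrite rec scalerA factS natrM invfM mulrAC mulVf ?mul1r// pnatr_eq0//.
Qed.

(** * The Teichmueller character *)

Section Teichmuller.
Variables (p : nat) (p_pr : prime p).

Definition teichmuller (u : {unit 'Z_p}) : padicInt p_pr :=
  xget 0 [set z | z ^+ p.-1 = 1 /\ toUnit p (zmod z 1) = u].

(* omega(a) for a p-adic unit a, by reduction mod p. *)
Definition teichmuller_padic (a : padicInt p_pr) : padicInt p_pr :=
  teichmuller (toUnit p (zmod a 1)).

Definition angle (a : padicInt p_pr) : padicInt p_pr :=
  (teichmuller_padic a)^-1 * a.

End Teichmuller.

(** * Bernoulli measure and p-adic L-function *)

Notation padicUnit p_pr :=
  (set_type [set x : padicInt p_pr | x \is a GRing.unit]).

(* (Z/d)^* x Zp^* with the product of the discrete and p-adic topologies. *)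
Notation weightDomain p_pr d :=
  (discrete_topology {unit 'Z_d} * padicUnit p_pr)%type.

Definition frac_part (x : rat) : rat := x - (Num.floor x)%:~R.

Section PadicL.
Variables (p : nat) (p_pr : prime p) (K : realType).
Variable R : completeNonArchAlgType K p_pr.
Notation Zp := (padicInt p_pr).
Notation Qp := (padicNum p_pr).

Definition ofQp (x : Qp) : R := x%:A.
Definition ofZp (x : Zp) : R := ofQp (FracField.tofrac x).
Definition ofrat (q : rat) : R := ofQp (ratr q).

(* omega^(-k) as an R-valued character of level p. *)
Definition teich_inv (k : nat) (u : {unit 'Z_p}) : R :=
  ofZp ((teichmuller p_pr u)^-1 ^+ k).

(* The generalized Bernoulli number B_(n,psi), with f^(n-1) a power with integer
   exponent (n may be 0). *)
Definition gen_bernoulli (n N : nat) (psi : {unit 'Z_N} -> R) : R :=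
  let f := conductor psi in
  ofQp (f%:R ^ (n%:Z - 1)) *
  \sum_(1 <= a < f.+1)
     dir_eval (primitive psi) a * ofrat (bern_poly n).[a%:R / f%:R].

Section Measure.
Variables (d c : nat).
Notation X := (weightDomain p_pr d).

(* The integer c^(-1) depends on n. *)
Definition bern_dist (n a : nat) : rat :=
  let N := (d * p ^ n)%N in
  let c_inv : nat := (c%:R^-1 : 'Z_(d * p ^ (2 * n + 1))) in
  frac_part (a%:R / N%:R) - c%:R * frac_part ((c_inv * a)%:R / N%:R)
  + (c%:R - 1) / 2.

(* The extension by zero of f to Z/d x Zp, at the image of the integer a. *)
Definition ext0 (f : X -> R) (a : nat) : R :=
  if insub (a%:R : Zp) is Some u then
    if coprime a d then f (toUnit d a, u) else 0
  else 0.

Definition bern_sum (f : X -> R) (n : nat) : R :=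
  \sum_(a < d * p ^ n) ext0 f a * ofrat (bern_dist n a).

Definition bern_locconst (f : X -> R) : R := lim (bern_sum f n @[n --> \oo]).

Definition locally_constant (f : X -> R) : Prop :=
  forall x, \forall y \near x, f y = f x.

(* The extension of E_c to the continuous functions for the sup norm; only its
   values on continuous functions are determined. *)
Definition bern_integral : (X -> R) -> R :=
  xget (fun=> 0) [set Phi : (X -> R) -> R |
    {within [set f : {uniform X -> R} | continuous (f : X -> R)],
       continuous (Phi : {uniform X -> R} -> R)} /\
    forall f, locally_constant f -> Phi f = bern_locconst f].

End Measure.

(* The unit of Z/dp^m congruent to a_1 mod d and to a_2 mod p^m. *)
Definition crt_unit (d m : nat) (a : weightDomain p_pr d) :
    {unit 'Z_(d * p ^ m)} :=
  toUnit _ (chinese d (p ^ m) (val (a.1 : {unit 'Z_d}) : nat) (zmod (val a.2) m)).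

Definition padicL (d c m : nat) (w : weightDomain p_pr d -> R)
    (chi : {unit 'Z_(d * p ^ m)} -> R) : R :=
  bern_integral c (fun a =>
    inflate (d * p ^ m) (dir_mul chi (teich_inv 1)) (crt_unit m a) * w a).

Definition weight (d k : nat) (a : weightDomain p_pr d) : R :=
  ofZp (angle (val a.2) ^+ k).

End PadicL.

(* Main.v *)
Require Import Defs.
From HB Require Import structures.
From mathcomp Require Import all_boot all_order all_algebra all_fingroup.
From mathcomp Require Import cyclic generic_quotient ring zify.
From mathcomp Require Import all_classical reals topology.

Set Implicit Arguments.
Unset Strict Implicit.
Unset Printing Implicit Defensive.

Import Order.TTheory GRing.Theory Num.Theory.
Local Open Scope ring_scope.

(** Write k for the index n of the formula.  On X the integrand
    chi omega^-1 (a) <a>^(k-1) equals psi(a) a^(k-1), where psi is the primitive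
    character attached to chi omega^-k; also chi(c) <c>^k = psi(c) c^k.  With
    M = d p^N the claim concerns the limit of the sums of psi(a) a^(k-1) E_N(a)
    over the a < M prime to p.

    Let b be the residue of a / c modulo M and c b = a + q M.  Then
    E_N(a) = - q + (c - 1) / 2 ([bern_dist_quo]), and expanding (a + q M)^k gives

      k a^(k-1) E_N(a) = (a^k - c^k b^k) / M + k a^(k-1) (c - 1) / 2

    up to an integral multiple of M ([bern_sum_term]).  Since a |-> b permutes
    the residues and psi(a) = psi(c) psi(b), summing over a shows that k times
    the Riemann sum is

      (1 - psi(c) c^k) S_k(M) / M + k S_(k-1)(M) (c - 1) / 2

    up to a bounded multiple of M, with S_j(M) the sum of psi(a) a^j over the
    a < M prime to p.  Removing the multiples of p from the sum over all a < M
    costs the Euler factor 1 - psi(p) p^(k-1) ([power_sum_unitE]).  On a residue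
    class r modulo the conductor f, the power sum of exponent k is a difference
    of two values of the Bernoulli polynomial B_(k+1), whose second order Taylor
    expansion has linear coefficient (k + 1) B_k(r / f)
    ([sum_powers_second_order]).  Hence S_k(M) / M tends to
    (1 - psi(p) p^(k-1)) B_(k,psi), while S_(k-1)(M) tends to 0
    ([riemann_sum_cvg]).

    Two facts justify the passage from the integral to these sums.  The values
    psi(a) vanish when a is not prime to d, because d still divides the
    conductor of psi ([dvdn_twist_conductor]).  And the integral of a continuous
    function is the limit of its Riemann sums ([bern_integral_lim]): continuous
    functions are uniformly continuous by compactness, and the distribution is
    bounded and additive, so these limits exist and depend continuously on the
    function; since locally constant functions are dense, the limits are the
    values of every continuous extension. *)

(** * The groups of units modulo N *)

Lemma coprime_unitZ N (u : {unit 'Z_N}) : (1 < N)%N ->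
  coprime (val u : nat) N.
Proof. by move=> N1; have := valP u; rewrite -{1}[val u]natr_Zp unitZpE// coprime_sym. Qed.

Lemma ltn_unitZ N (u : {unit 'Z_N}) : (1 < N)%N -> (val u < N)%N.
Proof. by move=> N1; exact: leq_trans (ltn_ord (val u)) (eq_leq (Zp_cast N1)). Qed.

Lemma toUnit_val N (u : {unit 'Z_N}) : toUnit N (val u : nat) = u.
Proof.
by apply: val_inj; rewrite /toUnit -pmulrn natr_Zp insubdK// (valP u).
Qed.

(** 'Z_1 is the ring Z/2, whose unit group is trivial. *)
Lemma unit1_eq (u v : {unit 'Z_1}) : u = v.
Proof.
apply: val_inj; have := valP u; have := valP v.
by case: (val u) => [[|[|]]]// ?; case: (val v) => [[|[|]]]// ? _ _;
  apply: val_inj.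
Qed.

Lemma toUnit_inZ N (k : nat) : (1 < N)%N -> coprime k N ->
  val (toUnit N k) = k%:R :> 'Z_N.
Proof. by move=> N1 kN; rewrite insubdK// -?pmulrn// unitZpE// coprime_sym. Qed.

Lemma val_toUnit N (k : nat) : (1 < N)%N -> coprime k N ->
  (val (toUnit N k) : nat) = (k %% N)%N.
Proof. by move=> N1 kN; rewrite toUnit_inZ// val_Zp_nat. Qed.

Lemma toUnit_mod N (a b : nat) : (0 < N)%N -> a = b %[mod N] ->
  toUnit N a = toUnit N b.
Proof.
case: N => [|[|N]]// _ ab; first exact: unit1_eq.
by rewrite /toUnit -!pmulrn -(Zp_nat_mod _ a)// ab Zp_nat_mod.
Qed.

Lemma toUnitM N (a b : nat) : (0 < N)%N -> coprime a N -> coprime b N ->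
  toUnit N (a * b)%N = (toUnit N a * toUnit N b)%g.
Proof.
case: N => [|[|N]]// _ aN bN; first exact: unit1_eq.
by apply: val_inj; rewrite /= !toUnit_inZ ?coprimeMl ?aN// natrM.
Qed.

Lemma toUnit1 N : (0 < N)%N -> toUnit N 1%N = 1%g.
Proof.
case: N => [|[|N]]// _; first exact: unit1_eq.
by apply: val_inj; rewrite /= toUnit_inZ// coprime1n.
Qed.

Lemma toUnit_inj N (a b : nat) : (0 < N)%N -> coprime a N -> coprime b N ->
  toUnit N a = toUnit N b -> a = b %[mod N].
Proof.
case: N => [|[|N]]// _ aN bN; first by rewrite !modn1.
by move=> /(congr1 (fun u : {unit 'Z_N.+2} => val u : nat)); rewrite !val_toUnit.
Qed.

Lemma unitRed_toUnit N M (a : nat) : (0 < N)%N -> (M %| N)%N -> coprime a N ->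
  unitRed M (toUnit N a) = toUnit M a.
Proof.
move=> N0 MN aN; have M0 : (0 < M)%N by apply: dvdn_gt0 MN.
case: N N0 MN aN => [|[|N]]// _ MN aN.
  by move: MN; rewrite dvdn1 => /eqP ->; exact: unit1_eq.
by apply: toUnit_mod => //; rewrite val_toUnit// modn_dvdm.
Qed.

Lemma unitZ_toUnit N (u : {unit 'Z_N}) : (0 < N)%N ->
  exists2 a : nat, coprime a N & u = toUnit N a.
Proof.
case: N u => [|[|N]]// u _; first by exists 1%N => //; exact: unit1_eq.
by exists (val u); rewrite ?coprime_unitZ ?toUnit_val.
Qed.

(** * p-adic integers *)

Section PadicIntegers.
Variables (p : nat) (p_pr : prime p).
Notation Zp := (padicInt p_pr).
Implicit Types x y z : Zp.

Lemma zmod_nat k n : zmod (k%:R : Zp) n = (k %% p ^ n)%N.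
Proof.
elim: k => [|k IH]; first by rewrite zmod0 mod0n.
by rewrite -natr1 zmodD zmod1 IH modnDm addn1.
Qed.

Lemma zmod_small_level x n : (0 < n)%N -> (zmod x n %% p)%N = zmod x 1.
Proof. by move=> n0; have := zmod_le x n0; rewrite expn1. Qed.

Lemma padic_unitE x : (x \is a GRing.unit) = (zmod x 1 != 0%N).
Proof. by []. Qed.

Lemma zmodM_p z n : zmod (p%:R * z) n.+1 = (p * zmod z n)%N.
Proof.
rewrite zmodM zmod_nat modnMml -(zmod_le z (leqnSn n)).
by rewrite expnS -muln_modr.
Qed.

Lemma zmodB_eq0 x y n : zmod x n = zmod y n -> zmod (x - y) n = 0%N.
Proof.
move=> xy; have : (zmod (x - y)%R n + zmod y n = zmod y n %[mod p ^ n])%N.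
  by rewrite -zmodD subrK -xy zmod_small.
rewrite -[X in _ = X %[mod _]]add0n => /eqP.
by rewrite eqn_modDr mod0n zmod_small => /eqP.
Qed.

Lemma padic_natr_inj : injective (fun k => k%:R : Zp).
Proof.
move=> a b /= ab; have : zmod (a%:R : Zp) (a + b) = zmod (b%:R : Zp) (a + b).
  by rewrite ab.
have lt_p k : (k < p ^ k)%N by rewrite ltn_expl ?prime_gt1.
by rewrite !zmod_nat !modn_small// (leq_trans (lt_p _))//
  leq_exp2l ?prime_gt1// (leq_addl, leq_addr).
Qed.

Section Division.
Variables (j : nat) (w : Zp) (wj : zmod w j = 0%N).

Let dvd_w n : (p ^ j %| zmod w (n + j))%N.
Proof. by rewrite /dvdn zmod_le ?wj// leq_addl. Qed.

Let quo_coherent : coherent p (fun n => zmod w (n + j) %/ p ^ j)%N.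
Proof.
move=> n; apply/eqP; rewrite -(eqn_pmul2r (m := p ^ j)) ?expn_gt0 ?prime_gt0//.
rewrite !muln_modl -!expnD !divnK//.
by rewrite zmod_small addSn zmod_coherent.
Qed.

Lemma padic_divisible : exists z, w = p%:R ^+ j * z.
Proof.
exists (mkPadicInt p_pr quo_coherent); apply: padicInt_eq => n.
rewrite -natrX zmodM zmod_nat /= modnMml modnMmr mulnC divnK//.
by rewrite zmod_le ?leq_addr.
Qed.

End Division.

(** The cofactor of [x - y] in [x ^+ k - y ^+ k] is congruent to
    [k * x ^+ k.-1] modulo p, hence nonzero when k = p - 1. *)
Lemma root1_zmod_inj x y : x ^+ p.-1 = 1 -> y ^+ p.-1 = 1 ->
  zmod x 1 = zmod y 1 -> x = y.
Proof.
move=> x1 y1 xy; apply/eqP; rewrite -subr_eq0.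
have := subrXX x y p.-1; rewrite x1 y1 subrr => /esym/eqP.
rewrite mulf_eq0 => /orP[//|/eqP S0]; exfalso.
have zX (z : Zp) k : (zmod (z ^+ k) 1 = zmod z 1 ^ k %[mod p])%N.
  elim: k => [|k IH]; first by rewrite expr0 zmod1 expn1 modn_mod.
  by rewrite exprS zmodM expn1 modn_mod -modnMmr IH modnMmr expnS.
have zS k : (zmod (\sum_(i < k) x ^+ (p.-1.-1 - i) * y ^+ i)%R 1
    = \sum_(i < k) zmod x 1 ^ (p.-1.-1 - i) * zmod x 1 ^ i %[mod p])%N.
  elim: k => [|k IH]; first by rewrite !big_ord0 zmod0.
  rewrite !big_ord_recr zmodD zmodM expn1 modn_mod -modnDml IH modnDml.
  rewrite modnDmr -[in LHS]modnDmr -modnMm !zX -xy modnMm modnDmr.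
  by [].
have := zS p.-1; rewrite S0 zmod0 mod0n => /esym/eqP; rewrite -/(dvdn _ _).
have p1 := prime_gt1 p_pr.
under eq_bigr => i _.
  have /subnK e : (i <= p.-1.-1)%N by rewrite -ltnS prednK ?ltn_ord// -subn1 subn_gt0.
  by rewrite -expnD e; over.
rewrite sum_nat_const card_ord Euclid_dvdM// => /orP[|].
  by move=> /dvdn_leq; rewrite -subn1 subn_gt0 p1 => /(_ isT); lia.
rewrite Euclid_dvdX// => /andP[xp _].
have: zmod (x ^+ p.-1) 1 = 0%N.
  have := zX x p.-1; rewrite -{1}[p in (_ %% p)%N]expn1 zmod_small => ->.
  by apply/eqP; rewrite -/(dvdn _ _) dvdn_exp// -subn1 subn_gt0.
by rewrite x1 zmod1 expn1 modn_small.
Qed.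

(** [zmod z n = a ^ (p ^ n)]: Euler's theorem makes these residues coherent. *)
Lemma exists_root1_lift (a : nat) : coprime a p ->
  exists z : Zp, z ^+ p.-1 = 1 /\ zmod z 1 = (a %% p)%N.
Proof.
move=> ap; have cop n : coprime a (p ^ n) by rewrite coprimeXr.
have coh : coherent p (fun n => a ^ (p ^ n))%N.
  move=> n; case: n => [|n]; first by rewrite !modn1.
  have := Euler_exp_totient (cop n.+1); rewrite totient_pfactor//= => eul.
  have -> : (p ^ n.+2 = p ^ n.+1 + p.-1 * p ^ n * p)%N.
    by rewrite -mulnA -expnSr -mulSn prednK ?prime_gt0// expnS.
  by rewrite expnD expnM -modnMmr -modnXm eul modnXm exp1n modnMmr muln1.
exists (mkPadicInt p_pr coh); split; last first.
  by rewrite /= expn1 fermat_little.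
apply: padicInt_eq => n.
have zX k : zmod (mkPadicInt p_pr coh ^+ k) n = ((a ^ (p ^ n)) ^ k %% p ^ n)%N.
  elim: k => [//|k IH].
  by rewrite exprS zmodM IH /= modnMml modnMmr expnS.
rewrite zX zmod1 -expnM; case: n {zX} => [|n]; first by rewrite !modn1.
have := Euler_exp_totient (cop n.+1); rewrite totient_pfactor//= => eul.
have -> : (p ^ n.+1 * p.-1 = p.-1 * p ^ n * p)%N.
  by rewrite expnSr mulnAC [(p ^ n * _)%N]mulnC.
by rewrite expnM -modnXm eul modnXm exp1n.
Qed.

Section TeichmullerTheory.
Implicit Types u v : {unit 'Z_p}.

Let p_gt1 := prime_gt1 p_pr.

Lemma teichmuller_spec u :
  teichmuller p_pr u ^+ p.-1 = 1 /\ toUnit p (zmod (teichmuller p_pr u) 1) = u.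
Proof.
rewrite /teichmuller; case: xgetP => [z -> //|nex]; exfalso.
have [z [z1 zu]] := exists_root1_lift (coprime_unitZ u p_gt1).
apply: (nex z); split=> //; rewrite zu modn_small ?toUnit_val//.
exact: ltn_unitZ.
Qed.

Lemma zmod_root1_coprime z : z ^+ p.-1 = 1 -> coprime (zmod z 1) p.
Proof.
move=> z1; rewrite -[p in coprime _ p]expn1; apply: zmod_coprime.
rewrite -padic_unitE; apply: contraT => zN.
have : z ^+ p.-1 \is a GRing.unit by rewrite z1 unitr1.
by rewrite unitrX_pos ?(negbTE zN)// -subn1 subn_gt0.
Qed.

Lemma teichmuller_unit u : teichmuller p_pr u \is a GRing.unit.
Proof.
have [t1 _] := teichmuller_spec u.
by rewrite -(unitrX_pos _ (n := p.-1)) ?t1 ?unitr1// -subn1 subn_gt0.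
Qed.

(** Both sides are roots of unity of order dividing p - 1 with the same residue. *)
Lemma teichmullerM u v :
  teichmuller p_pr (u * v)%g = teichmuller p_pr u * teichmuller p_pr v.
Proof.
have [[uv1 uvE] [u1 uE] [v1 vE]] := And3 (teichmuller_spec (u * v)%g)
  (teichmuller_spec u) (teichmuller_spec v).
have uv1' : (teichmuller p_pr u * teichmuller p_pr v) ^+ p.-1 = 1.
  by rewrite exprMn u1 v1 mulr1.
apply: root1_zmod_inj => //; rewrite zmodM expn1.
have := congr1 val uvE; rewrite toUnit_inZ ?zmod_root1_coprime//.
rewrite -{2}uE -{2}vE /= !toUnit_inZ ?zmod_root1_coprime//.
rewrite -natrM => /(congr1 (fun x : 'Z_p => x : nat)); rewrite !val_Zp_nat// => <-.
by rewrite zmod_small_level.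
Qed.

End TeichmullerTheory.

End PadicIntegers.

(** * Dirichlet characters *)

Section Characters.
Variable R : comNzRingType.

Section OneLevel.
Variables (N : nat) (N0 : (0 < N)%N) (psi : {unit 'Z_N} -> R).

Lemma dir_eval_coprime (a : nat) : coprime a N ->
  dir_eval psi a = psi (toUnit N a).
Proof. by rewrite /dir_eval coprimezE => ->. Qed.

Lemma dir_eval_eq0 (a : nat) : ~~ coprime a N -> dir_eval psi a = 0.
Proof. by rewrite /dir_eval coprimezE => /negbTE ->. Qed.

Lemma dir_eval_mod (a b : nat) : a = b %[mod N] -> dir_eval psi a = dir_eval psi b.
Proof.
move=> ab; have [cb|cb] := boolP (coprime b N).
  rewrite !dir_eval_coprime//; last by rewrite -coprime_modl ab coprime_modl.
  by congr psi; exact: toUnit_mod.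
by rewrite !dir_eval_eq0// -coprime_modl ab coprime_modl.
Qed.

Lemma conductor_dvd : (conductor psi %| N)%N.
Proof. by rewrite /conductor; case: ex_minnP => f /andP[]. Qed.

Lemma conductor_gt0 : (0 < conductor psi)%N.
Proof. exact: dvdn_gt0 N0 conductor_dvd. Qed.

Lemma conductor_min f : (f %| N)%N -> factors_through psi f ->
  (conductor psi <= f)%N.
Proof.
move=> fN ff; rewrite /conductor; case: ex_minnP => g _; apply.
by rewrite fN; apply/asboolP.
Qed.

Lemma primitive_unitRed u : primitive psi (unitRed _ u) = psi u.
Proof.
by rewrite /primitive; case: cid => phi /= e; rewrite [in RHS]e.
Qed.

Lemma primitive_toUnit (a : nat) : coprime a N ->
  primitive psi (toUnit _ a) = psi (toUnit N a).
Proof.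
by move=> aN; rewrite -primitive_unitRed unitRed_toUnit// conductor_dvd.
Qed.

(** The values of psi at arbitrary lifts define a character of level f. *)
Lemma factors_throughP f : (f %| N)%N ->
  factors_through psi f <->
  forall a b : nat, coprime a N -> coprime b N -> a = b %[mod f] ->
    psi (toUnit N a) = psi (toUnit N b).
Proof.
move=> fN; have f0 := dvdn_gt0 N0 fN.
split=> [[phi ->] a b aN bN ab|H].
  by rewrite /= !unitRed_toUnit//; congr phi; exact: toUnit_mod.
exists (fun v => psi (xget 1%g [set u | unitRed f u = v]%classic)).
apply/funext => u /=; case: xgetP => [v _ /=|nex]; last by have /(_ erefl) := nex u.
have [[a aN ->] [b bN ->]] := (unitZ_toUnit u N0, unitZ_toUnit v N0).
rewrite !unitRed_toUnit// => /toUnit_inj ab.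
by apply: H => //; rewrite ab// (coprime_dvdr fN).
Qed.

(** If a = b mod f and c is an inverse of b modulo N, then a c = 1 mod f. *)
Lemma dirichlet_factors f : is_dirichlet psi -> (f %| N)%N ->
  (forall a : nat, coprime a N -> a = 1 %[mod f] -> psi (toUnit N a) = 1) ->
  factors_through psi f.
Proof.
move=> [psi1 psiM] fN H; apply/factors_throughP => // a b aN bN ab.
have [c cN bc] := unitZ_toUnit (toUnit N b)^-1%g N0.
have bc1 : psi (toUnit N b) * psi (toUnit N c) = 1.
  by rewrite -bc -psiM mulgV psi1.
have ac1 : psi (toUnit N a) * psi (toUnit N c) = 1.
  rewrite -psiM -toUnitM//; apply: H; first by rewrite coprimeMl aN.
  rewrite -modnMml ab modnMml.
  have : toUnit N (b * c)%N = toUnit N 1%N by rewrite toUnitM// -bc mulgV toUnit1.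
  move=> /toUnit_inj; rewrite coprimeMl bN cN coprime1n => /(_ N0 isT isT) e.
  by rewrite -(modn_dvdm _ fN) e modn_dvdm.
by rewrite -[LHS]mulr1 -bc1 mulrCA ac1 mulr1.
Qed.

End OneLevel.

Lemma conductor_primitive N (psi : {unit 'Z_N} -> R) : (0 < N)%N ->
  conductor (primitive psi) = conductor psi.
Proof.
move=> N0; apply/eqP; rewrite eqn_leq dvdn_leq ?conductor_gt0 ?conductor_dvd//=.
have f0 := conductor_gt0 N0 psi; have fN := conductor_dvd psi.
apply: conductor_min; first exact: dvdn_trans (conductor_dvd _) fN.
apply/factors_throughP => //; first exact: dvdn_trans (conductor_dvd _) fN.
have /(factors_throughP f0 _ (conductor_dvd _)) H := conductor_factors (primitive psi).
move=> a b aN bN ab; rewrite -(primitive_toUnit N0 psi aN) -(primitive_toUnit N0 psi bN).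
by apply: H => //; apply: coprime_dvdr fN _.
Qed.

Lemma dir_eval_primitive2 N (psi : {unit 'Z_N} -> R) (a : nat) : (0 < N)%N ->
  dir_eval (primitive (primitive psi)) a = dir_eval (primitive psi) a.
Proof.
move=> N0; have e := conductor_primitive psi N0.
have f0 := conductor_gt0 N0 psi.
have [af|af] := boolP (coprime a (conductor psi)); last first.
  by rewrite !dir_eval_eq0// e.
by rewrite !dir_eval_coprime ?e// primitive_toUnit.
Qed.

End Characters.

(** * Twisting a character of level d p^m by a character of level p *)

Section Twist.
Variables (p : nat) (p_pr : prime p) (d m : nat).
Hypotheses (d_gt0 : (0 < d)%N) (cop_dp : coprime d p) (m_gt0 : (0 < m)%N).
Variable R : comNzRingType.
Notation N := (d * p ^ m)%N.
Variables (chi : {unit 'Z_N} -> R) (theta : {unit 'Z_p} -> R).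
Hypotheses (chiD : is_dirichlet chi) (thetaD : is_dirichlet theta).
Hypothesis d_cond : (d %| conductor chi)%N.
Notation L := (lcmn N p).
Notation Psi := (dir_mul_lcm chi theta).
Notation f := (conductor Psi).

Let p_gt0 := prime_gt0 p_pr.
Let cop_dpm : coprime d (p ^ m). Proof. by rewrite coprimeXr. Qed.

Let N_gt0 : (0 < N)%N. Proof. by rewrite muln_gt0 d_gt0 expn_gt0 p_gt0. Qed.
Let pN : (p %| N)%N. Proof. by rewrite dvdn_mull// dvdn_exp. Qed.
Let LE : L = N.
Proof. by apply/eqP; rewrite eqn_dvd dvdn_lcm dvdn_lcml dvdnn pN. Qed.
Let L_gt0 : (0 < L)%N. Proof. by rewrite LE. Qed.

Lemma twist_conductor_dvd : (f %| N)%N.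
Proof. by apply: dvdn_trans (conductor_dvd _) _; rewrite LE. Qed.

Let f_gt0 : (0 < f)%N. Proof. exact: conductor_gt0. Qed.

Let coprimeN a : coprime a N = coprime a d && coprime a p.
Proof. by rewrite coprimeMr coprime_pexpr. Qed.

Let Psi_toUnit (a : nat) : coprime a N ->
  Psi (toUnit L a) = chi (toUnit N a) * theta (toUnit p a).
Proof.
move=> aN; rewrite /dir_mul_lcm /inflate /= !unitRed_toUnit ?LE ?dvdnn//.
Qed.

Lemma dir_mul_toUnit (a : nat) : coprime a N ->
  dir_mul chi theta (toUnit f a) = chi (toUnit N a) * theta (toUnit p a).
Proof.
by move=> aN; rewrite /dir_mul primitive_toUnit ?LE// Psi_toUnit.
Qed.

Let PsiM (a b : nat) : coprime a N -> coprime b N ->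
  Psi (toUnit L (a * b)%N) = Psi (toUnit L a) * Psi (toUnit L b).
Proof.
move=> aN bN; rewrite !Psi_toUnit// ?coprimeMl ?aN//.
move: aN bN; rewrite !coprimeN => /andP[ad ap] /andP[bd bp].
rewrite !toUnitM// ?coprimeN ?ad ?bd//.
by rewrite chiD.2 thetaD.2 mulrACA.
Qed.

(** Write the conductor of chi as d * e1 with e1 | p ^ m.  If the conductor f
    of the twist had a smaller part d' prime to p, then chi would factor
    through d' * e1: modify a = 1 mod d' * e1 to be 1 modulo p ^ m without
    changing it modulo d, and use that the twist only affects the p-part. *)
Lemma dvdn_twist_conductor : (d %| f)%N.
Proof.
set d' := gcdn f d.
have d'd : (d' %| d)%N := dvdn_gcdr _ _.
have [e1 eE] : exists e1, conductor chi = (d * e1)%N.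
  by have /dvdnP[e1 ->] := d_cond; exists e1; exact: mulnC.
have e1p : (e1 %| p ^ m)%N.
  by have := conductor_dvd chi; rewrite eE dvdn_pmul2l.
have e1_gt0 : (0 < e1)%N by rewrite (dvdn_gt0 _ e1p)// expn_gt0 p_gt0.
have f_dvd : (f %| d' * p ^ m)%N.
  by rewrite muln_gcdl dvdn_gcd dvdn_mulr//= twist_conductor_dvd.
have cop_d'p : coprime d' (p ^ m) := coprime_dvdl d'd cop_dpm.
have cop_de : coprime d e1 := coprime_dvdr e1p cop_dpm.
have fact : factors_through chi (d' * e1).
  apply: dirichlet_factors => //; first by rewrite dvdn_mul.
  move=> a aN a1.
  pose b := chinese d (p ^ m) a 1.
  have bd : b = a %[mod d] := chinese_modl cop_dpm a 1.
  have bp : b = 1 %[mod p ^ m] := chinese_modr cop_dpm a 1.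
  have [ad ap] := andP (etrans (esym (coprimeN a)) aN).
  have bN : coprime b N.
    rewrite coprimeMr -coprime_modl bd coprime_modl ad.
    by rewrite -coprime_modl bp coprime_modl coprime1n.
  have modD x y k l : (k %| l)%N -> x = y %[mod l] -> x = y %[mod k].
    by move=> kl xy; rewrite -(modn_dvdm x kl) xy modn_dvdm.
  have -> : chi (toUnit N a) = chi (toUnit N b).
    have := conductor_factors chi.
    move=> /(factors_throughP N_gt0 _ (conductor_dvd _)); apply => //.
    apply/eqP; rewrite eE chinese_remainder// bd eqxx /=; apply/eqP.
    by rewrite (modD _ _ _ _ (dvdn_mull d' (dvdnn e1)) a1) (modD _ _ _ _ e1p bp).
  have b1 : b = 1 %[mod f].
    apply: (modD _ _ _ _ f_dvd); apply/eqP; rewrite chinese_remainder// bp eqxx andbT.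
    apply/eqP; rewrite (modD _ _ _ _ d'd bd).
    exact: (modD _ _ _ _ (dvdn_mulr e1 (dvdnn d')) a1).
  have := conductor_factors Psi.
  move=> /(factors_throughP L_gt0 _ (conductor_dvd _)) /(_ b 1%N).
  have bL : coprime b L by rewrite LE.
  move=> /(_ bL (coprime1n _) b1).
  rewrite !Psi_toUnit ?coprime1n// !toUnit1// chiD.1 thetaD.1 mulr1.
  have -> : toUnit p b = toUnit p 1%N.
    by apply: toUnit_mod => //; apply: (modD _ _ _ _ _ bp); rewrite dvdn_exp.
  by rewrite toUnit1// thetaD.1 mulr1.
have := conductor_min _ fact; rewrite dvdn_mul// => /(_ isT).
rewrite eE leq_pmul2r// => dd'.
have antisym_dvd x y : (0 < x)%N -> (y %| x)%N -> (x <= y)%N -> (x %| y)%N.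
  move=> x0 yx xy; suff -> : x = y by [].
  by apply/eqP; rewrite eqn_leq xy dvdn_leq.
exact: dvdn_trans (antisym_dvd _ _ d_gt0 d'd dd') (dvdn_gcdl f d).
Qed.

(** Only p can divide the level without dividing f; when p divides a it does
    not divide f, so f divides d and a can be changed to be 1 modulo p ^ m. *)
Let lift_coprime (a : nat) : coprime a f ->
  exists2 a' : nat, coprime a' N & a' = a %[mod f].
Proof.
move=> af; have ad := coprime_dvdr dvdn_twist_conductor af.
have [ap|] := boolP (coprime a p); first by exists a; rewrite ?coprimeN ?ad.
rewrite coprime_sym prime_coprime// negbK => pa.
have pf : coprime f (p ^ m).
  rewrite coprimeXr// coprime_sym prime_coprime//; apply/negP => pf.
  move: (coprime_dvdl pa af); rewrite prime_coprime//.
  by rewrite pf.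
have fd : (f %| d)%N by have := twist_conductor_dvd; rewrite Gauss_dvdl.
exists (chinese d (p ^ m) a 1).
  rewrite coprimeMr -coprime_modl chinese_modl// coprime_modl ad.
  by rewrite -coprime_modl chinese_modr// coprime_modl coprime1n.
by rewrite -(modn_dvdm _ fd) chinese_modl// modn_dvdm.
Qed.

Lemma dir_mul_evalM (a b : nat) :
  dir_eval (dir_mul chi theta) (a * b)%N =
  dir_eval (dir_mul chi theta) a * dir_eval (dir_mul chi theta) b.
Proof.
have [af|af] := boolP (coprime a f); last first.
  by rewrite [LHS]dir_eval_eq0 ?[X in X * _]dir_eval_eq0 ?mul0r// coprimeMl negb_and af.
have [bf|bf] := boolP (coprime b f); last first.
  rewrite [LHS]dir_eval_eq0 ?[X in _ * X]dir_eval_eq0 ?mulr0//.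
  by rewrite coprimeMl negb_and bf orbT.
have [[a' a'N aE] [b' b'N bE]] := (lift_coprime af, lift_coprime bf).
rewrite (@dir_eval_mod _ _ f_gt0 _ (a * b) (a' * b')); last first.
  by rewrite -modnMm -aE -bE modnMm.
rewrite -(@dir_eval_mod _ _ f_gt0 _ _ _ aE) -(@dir_eval_mod _ _ f_gt0 _ _ _ bE).
have cf x : coprime x N -> coprime x f := coprime_dvdr twist_conductor_dvd.
rewrite !dir_eval_coprime ?cf ?coprimeMl ?a'N//.
by rewrite /dir_mul !primitive_toUnit ?LE ?coprimeMl ?a'N// PsiM.
Qed.

End Twist.

(** * The p-adic absolute value *)

Section PadicAbs.
Variables (p : nat) (p_pr : prime p) (K : realType).
Notation Zp := (padicInt p_pr).
Notation Qp := (padicNum p_pr).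
Implicit Types x y z : Zp.

Let p_gt0 : 0 < p%:R :> K. Proof. by rewrite ltr0n prime_gt0. Qed.
Let p_ge1 : 1 <= p%:R :> K. Proof. by rewrite ler1n prime_gt0. Qed.

Lemma padicInt_abs_pos x : x != 0 ->
  exists2 n, padicInt_abs K x = p%:R ^- n &
    zmod x n.+1 != 0%N /\ zmod x n = 0%N.
Proof.
move=> x0; rewrite /padicInt_abs; case: pselect => [ex|nex]; last first.
  case/eqP: x0; apply: padicInt_eq => n; rewrite zmod0; apply/eqP.
  by apply: contraT => xn; case: nex; exists n.
case: ex_minnP => -[|n] xn min_n; first by have := zmod_lt x 0; case: zmod xn.
exists n => //; split=> //; apply/eqP; apply: contraT => /min_n.
by rewrite ltnn.
Qed.

Lemma padicInt_abs0 : padicInt_abs K (0 : Zp) = 0.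
Proof.
by rewrite /padicInt_abs; case: pselect => // ex; exfalso; case: ex => n; rewrite zmod0.
Qed.

Lemma padicInt_abs_gt0 x : x != 0 -> 0 < padicInt_abs K x.
Proof. by move=> /padicInt_abs_pos[n -> _]; rewrite invr_gt0 exprn_gt0. Qed.

Lemma zmod_eq0_le x n k : (k <= n)%N -> zmod x n = 0%N -> zmod x k = 0%N.
Proof. by move=> kn xn; rewrite -(zmod_le x kn) xn mod0n. Qed.

(** The residues of [z * x] vanish at every level where those of x do. *)
Lemma padicInt_abs_dvd x z : padicInt_abs K (z * x) <= padicInt_abs K x.
Proof.
have [->|zx0] := eqVneq (z * x) 0.
  have [->|x0] := eqVneq x 0; first by rewrite padicInt_abs0.
  by rewrite padicInt_abs0 ltW ?padicInt_abs_gt0.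
have x0 : x != 0 by apply: contraNneq zx0 => ->; rewrite mulr0.
have [n -> [zxn _]] := padicInt_abs_pos zx0.
have [k -> [_ xk]] := padicInt_abs_pos x0.
rewrite lef_pV2 ?posrE ?exprn_gt0// ler_weXn2l// leqNgt; apply: contra zxn => nk.
by rewrite zmodM (zmod_eq0_le nk xk) muln0 mod0n.
Qed.

Lemma padicInt_absMp x : x != 0 ->
  padicInt_abs K (p%:R * x) <= 2^-1 * padicInt_abs K x.
Proof.
move=> x0; have px0 : p%:R * x != 0 :> Zp.
  rewrite mulf_neq0//; apply/eqP => /(@padic_natr_inj _ p_pr p 0).
  by move=> p0; move: p_gt0; rewrite p0 ltxx.
have [k -> [xk xk0]] := padicInt_abs_pos x0.
have [n -> [pxn pxn0]] := padicInt_abs_pos px0.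
have kn : (k.+1 <= n)%N.
  rewrite ltnNge; apply: contra pxn => nk.
  by rewrite zmodM_p (zmod_eq0_le nk xk0) muln0.
rewrite (@le_trans _ _ (p%:R ^- k.+1))//.
  by rewrite lef_pV2 ?posrE ?exprn_gt0// ler_weXn2l.
rewrite exprS invfM ler_wpM2r//; first by rewrite invr_ge0 exprn_ge0// ltW.
by rewrite lef_pV2 ?posrE// ler_nat prime_gt1.
Qed.

Lemma repr_tofrac z : \n_(repr (FracField.tofrac z)) =
  z * \d_(repr (FracField.tofrac z)).
Proof.
unlock FracField.tofrac; have := FracField.equivf_r (Ratio z 1).
by rewrite !numden_Ratio ?oner_neq0// mul1r => /esym.
Qed.

Lemma padic_abs_int z : padic_abs K (FracField.tofrac z) <= 1.
Proof.
rewrite /padic_abs repr_tofrac ler_pdivrMr ?mul1r ?padicInt_abs_dvd//.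
exact/padicInt_abs_gt0/denom_ratioP.
Qed.

Lemma padic_abs_p : padic_abs K (p%:R : Qp) <= 2^-1.
Proof.
have -> : p%:R = FracField.tofrac p%:R :> Qp by rewrite rmorph_nat.
rewrite /padic_abs repr_tofrac ler_pdivrMr ?padicInt_absMp//.
  exact: denom_ratioP.
exact/padicInt_abs_gt0/denom_ratioP.
Qed.

Lemma padic_abs_ge0 (x : Qp) : 0 <= padic_abs K x.
Proof.
have ge0 z : 0 <= padicInt_abs K z.
  by have [->|/padicInt_abs_gt0/ltW//] := eqVneq z 0; rewrite padicInt_abs0.
by rewrite /padic_abs divr_ge0.
Qed.

Lemma padic_natr_neq0 n : (0 < n)%N -> n%:R != 0 :> Qp.
Proof.
rewrite lt0n; apply: contraNneq => /eqP.
rewrite -(rmorph_nat (@FracField.tofrac Zp)) -(rmorph0 (@FracField.tofrac Zp)).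
by rewrite tofrac_eq => /eqP/(@padic_natr_inj _ p_pr n 0) ->.
Qed.

Let padic_intr_neq0 (n : int) : n != 0 -> n%:~R != 0 :> Qp.
Proof.
case: n => n n0; first by rewrite -pmulrn padic_natr_neq0 ?lt0n.
by rewrite NegzE mulrNz oppr_eq0 -pmulrn padic_natr_neq0.
Qed.

(** The representation a / b is arbitrary, so that sums and products can be
    compared over a common denominator. *)
Let ratr_frac (q : rat) (a b : int) : b != 0 -> q * b%:~R = a%:~R ->
  ratr q * b%:~R = a%:~R :> Qp.
Proof.
move=> b0 qE; have d0 : (denq q)%:~R != 0 :> Qp by rewrite padic_intr_neq0.
have e : numq q * b = a * denq q.
  apply: (@intr_inj rat); rewrite !intrM -qE mulrAC.
  by rewrite -{2}[q]divq_num_den divfK// intr_eq0.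
apply: (mulIf d0); rewrite /ratr mulrAC divfK//.
by rewrite -!intrM e.
Qed.

Let rat_num_den (q : rat) : q * (denq q)%:~R = (numq q)%:~R.
Proof. by rewrite -{1}[q]divq_num_den divfK// intr_eq0. Qed.

Let ratr_num_den (q : rat) : ratr q * (denq q)%:~R = (numq q)%:~R :> Qp.
Proof. exact: ratr_frac. Qed.

Let ratr_den_neq0 (x y : rat) : (denq x * denq y)%:~R != 0 :> Qp.
Proof. by rewrite padic_intr_neq0// mulf_neq0. Qed.

Lemma padic_ratr_zmod_morphism : zmod_morphism (ratr : rat -> Qp).
Proof.
move=> x y; apply: (mulIf (ratr_den_neq0 x y)).
have split_den (F : comPzRingType) (a b c e : F) :
  (a - b) * (c * e) = a * c * e - b * e * c by ring.
rewrite (@ratr_frac _ (numq x * denq y - numq y * denq x)) ?mulf_neq0//.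
  by rewrite intrB !intrM split_den !ratr_num_den.
by rewrite intrB !intrM split_den !rat_num_den.
Qed.

Lemma padic_ratr_monoid_morphism : monoid_morphism (ratr : rat -> Qp).
Proof.
split=> [|x y]; first by rewrite -[1%R]/(1%:R) ratr_nat.
apply: (mulIf (ratr_den_neq0 x y)).
rewrite (@ratr_frac _ (numq x * numq y)) ?mulf_neq0//.
  by rewrite !intrM mulrACA !ratr_num_den.
by rewrite !intrM mulrACA !rat_num_den.
Qed.

End PadicAbs.

(** * Non-Archimedean norms *)

Section Norm.
Variables (p : nat) (p_pr : prime p) (K : realType).
Variable R : completeNonArchAlgType K p_pr.
Notation Zp := (padicInt p_pr).
Notation Qp := (padicNum p_pr).
Implicit Types x y : R.

Lemma ofQp_zmod_morphism : zmod_morphism (ofQp R).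
Proof. by move=> x y; rewrite /ofQp scalerBl. Qed.
Lemma ofQp_monoid_morphism : monoid_morphism (ofQp R).
Proof. by split=> [|x y]; rewrite /ofQp ?scale1r// -scalerAl mul1r scalerA. Qed.
HB.instance Definition _ :=
  GRing.isZmodMorphism.Build Qp R (ofQp R) ofQp_zmod_morphism.
HB.instance Definition _ :=
  GRing.isMonoidMorphism.Build Qp R (ofQp R) ofQp_monoid_morphism.

Lemma ofZp_zmod_morphism : zmod_morphism (ofZp R).
Proof. by move=> x y; rewrite /ofZp !rmorphB. Qed.
Lemma ofZp_monoid_morphism : monoid_morphism (ofZp R).
Proof. by split=> [|x y]; rewrite /ofZp ?rmorph1// !rmorphM. Qed.
HB.instance Definition _ :=
  GRing.isZmodMorphism.Build Zp R (ofZp R) ofZp_zmod_morphism.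
HB.instance Definition _ :=
  GRing.isMonoidMorphism.Build Zp R (ofZp R) ofZp_monoid_morphism.

Lemma ofrat_zmod_morphism : zmod_morphism (ofrat R).
Proof.
move=> x y; rewrite /ofrat; move: (padic_ratr_zmod_morphism p_pr x y) => /= ->.
exact: ofQp_zmod_morphism.
Qed.
Lemma ofrat_monoid_morphism : monoid_morphism (ofrat R).
Proof.
have [r1 rM] := padic_ratr_monoid_morphism p_pr.
by split=> [|x y]; rewrite /ofrat ?r1 ?rM ?rmorph1 ?rmorphM.
Qed.
HB.instance Definition _ :=
  GRing.isZmodMorphism.Build rat R (ofrat R) ofrat_zmod_morphism.
HB.instance Definition _ :=
  GRing.isMonoidMorphism.Build rat R (ofrat R) ofrat_monoid_morphism.

Lemma nnorm0 : nnorm (0 : R) = 0. Proof. exact/nnorm_eq0. Qed.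

Lemma nnormB x y : nnorm (x - y) = nnorm (y - x).
Proof. by rewrite -!mdist_nnorm metric_sym. Qed.

Lemma nnormN x : nnorm (- x) = nnorm x.
Proof. by rewrite -sub0r nnormB subr0. Qed.

Lemma nnorm1_gt0 : 0 < nnorm (1 : R).
Proof.
rewrite lt_neqAle nnorm_ge0 andbT eq_sym.
by apply/eqP => /nnorm_eq0/eqP; rewrite oner_eq0.
Qed.

Lemma nnormD_le x y (C : K) : nnorm x <= C -> nnorm y <= C -> nnorm (x + y) <= C.
Proof. by move=> xC yC; rewrite (le_trans (nnormD_max _ _))// ge_max xC. Qed.

Lemma nnorm_sum_le (I : Type) (r : seq I) (P : pred I) (F : I -> R) (C : K) :
  0 <= C -> (forall i, P i -> nnorm (F i) <= C) ->
  nnorm (\sum_(i <- r | P i) F i) <= C.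
Proof.
move=> C0 FC; elim/big_ind : _ => //; first by rewrite nnorm0.
by move=> x y; exact: nnormD_le.
Qed.

Lemma nnormM_ofQp (a : Qp) x : nnorm (ofQp R a * x) = padic_abs K a * nnorm x.
Proof. by rewrite /ofQp mulr_algl nnormZ. Qed.

Lemma nnormM_ofZp (a : Zp) x : nnorm (ofZp R a * x) <= nnorm x.
Proof.
rewrite /ofZp nnormM_ofQp -[leRHS]mul1r ler_wpM2r ?nnorm_ge0//.
exact: padic_abs_int.
Qed.

Lemma nnorm_ofZp (a : Zp) : nnorm (ofZp R a) <= nnorm (1 : R).
Proof. by rewrite -[ofZp R a]mulr1 nnormM_ofZp. Qed.

Lemma nnorm_natr n : nnorm (n%:R : R) <= nnorm (1 : R).
Proof. by rewrite -(rmorph_nat (ofZp R)) nnorm_ofZp. Qed.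

Lemma nnormM_le_bound x y (B C : K) : 0 <= B -> nnorm x <= B -> nnorm y <= C ->
  nnorm (x * y) <= B * C.
Proof.
move=> B0 xB yC; rewrite (le_trans (nnormM_le _ _))// ler_pM ?nnorm_ge0//.
Qed.

Notation rho := (padic_abs K (p%:R : Qp)).

Lemma nnormM_pX n x : nnorm (p%:R ^+ n * x) = rho ^+ n * nnorm x.
Proof.
elim: n => [|n IH]; first by rewrite !expr0 !mul1r.
by rewrite !exprS -mulrA -(rmorph_nat (ofQp R)) nnormM_ofQp rmorph_nat IH mulrA.
Qed.

(** The absolute value of p is at most 1 / 2. *)
Lemma rho_small (C eps : K) : 0 <= C -> 0 < eps ->
  exists n0, forall n, (n0 <= n)%N -> rho ^+ n * C < eps.
Proof.
move=> C0 eps0; exists (Num.bound (C / eps)) => n /upper_nthrootP.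
rewrite ltr_pdivrMr// => Clt; apply: (@le_lt_trans _ _ (2^-1 ^+ n * C)).
  by rewrite ler_wpM2r// lerXn2r ?nnegrE ?padic_abs_ge0 ?invr_ge0 ?padic_abs_p.
by rewrite exprVn mulrC ltr_pdivrMr ?exprn_gt0// mulrC.
Qed.

Lemma padic_close (x y : Zp) n : zmod x n = zmod y n ->
  nnorm (ofZp R x - ofZp R y) <= rho ^+ n * nnorm (1 : R).
Proof.
move=> /zmodB_eq0/padic_divisible[z zE].
rewrite -rmorphB zE rmorphM rmorphXn /= rmorph_nat nnormM_pX.
by rewrite ler_wpM2l ?exprn_ge0 ?padic_abs_ge0 ?nnorm_ofZp.
Qed.

(** ** Convergence of sequences *)

Local Open Scope classical_set_scope.

Lemma nnorm_cvgP (u : nat -> R) (l : R) : u n @[n --> \oo] --> l <->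
  forall eps : K, 0 < eps -> exists n0, forall n, (n0 <= n)%N ->
    nnorm (u n - l) <= eps.
Proof.
split=> [/metricType_numDomainType.cvgr_dist_le ul eps eps0|H].
  have [n0 _ h] := ul _ eps0; exists n0 => n /h /=.
  by rewrite mdist_nnorm nnormB.
apply/metricType_numDomainType.cvgrPdist_le => eps eps0.
have [n0 h] := H _ eps0; exists n0 => // n /= /h.
by rewrite mdist_nnorm nnormB.
Qed.

Lemma cvg_shift (u : nat -> R) (l : R) m :
  u (n + m)%N @[n --> \oo] --> l -> u n @[n --> \oo] --> l.
Proof.
move=> /nnorm_cvgP ul; apply/nnorm_cvgP => eps /ul[n0 h].
exists (n0 + m)%N => n n0m; have mn : (m <= n)%N by apply: leq_trans n0m; exact: leq_addl.
by rewrite -(subnK mn) h// leq_subRL// addnC.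
Qed.

Lemma nnorm_lim (u : nat -> R) (l : R) : u n @[n --> \oo] --> l ->
  lim (u n @[n --> \oo]) = l.
Proof. by move=> ul; apply: cvg_lim => //; exact: metric_hausdorff. Qed.

(** By the ultrametric inequality the distance of two terms is at most the
    largest distance of consecutive terms between them. *)
Lemma nnorm_cauchy (u : nat -> R) :
  (forall eps : K, 0 < eps -> exists n0, forall n, (n0 <= n)%N ->
    nnorm (u n.+1 - u n) <= eps) -> exists l : R, u n @[n --> \oo] --> l.
Proof.
move=> H; suff /cvg_ex : cvg (u n @[n --> \oo]) by [].
apply: cauchy_cvg; apply: cauchy_exP => eps eps0.
have eps20 : 0 < eps / 2 by rewrite divr_gt0.
have [n0 h] := H _ eps20; exists (u n0); exists n0 => // n /= n0n.
rewrite ballEmdist /= mdist_nnorm (@le_lt_trans _ _ (eps / 2))//; last first.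
  by rewrite ltr_pdivrMr// ltr_pMr// ltr1n.
rewrite nnormB -(subnK n0n); elim: (n - n0)%N => [|k IH].
  by rewrite subrr nnorm0 ltW.
rewrite addSn -(subrK (u (k + n0)%N) (u (k + n0).+1)) -addrA.
by rewrite nnormD_le// h// leq_addl.
Qed.

(** ** Bounded sequences *)

Definition bounded_seq (u : nat -> R) := exists C, forall n, nnorm (u n) <= C.

Lemma bounded_seq_cst x : bounded_seq (fun=> x).
Proof. by exists (nnorm x). Qed.

Lemma bounded_seq_natr (h : nat -> nat) : bounded_seq (fun n => (h n)%:R).
Proof. by exists (nnorm (1 : R)) => n; exact: nnorm_natr. Qed.

Lemma bounded_seqD u v : bounded_seq u -> bounded_seq v ->
  bounded_seq (fun n => u n + v n).
Proof.
move=> [C uC] [D vD]; exists (Num.max C D) => n.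
by rewrite nnormD_le// le_max ?uC ?vD ?orbT.
Qed.

Lemma bounded_seqM u v : bounded_seq u -> bounded_seq v ->
  bounded_seq (fun n => u n * v n).
Proof.
move=> [C uC] [D vD]; exists (C * D) => n.
by rewrite nnormM_le_bound// (le_trans _ (uC 0%N)) ?nnorm_ge0.
Qed.

Lemma bounded_seq_sum_ord (F : nat -> nat -> R) k :
  (forall i, bounded_seq (F i)) -> bounded_seq (fun n => \sum_(i < k) F i n).
Proof.
move=> FC; elim: k => [|k IH]; first by exists 0 => n; rewrite big_ord0 nnorm0.
by under eq_fun => n do rewrite big_ord_recr /=; exact: bounded_seqD.
Qed.

(** The error terms of the Riemann sums come in this form. *)
Lemma cvg_up_to_pX (u v : nat -> R) (l : R) : bounded_seq v ->
  (forall n, u n = l + p%:R ^+ n * v n) -> u n @[n --> \oo] --> l.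
Proof.
move=> [C vC] uE; apply/nnorm_cvgP => eps eps0.
have C0 : 0 <= C by rewrite (le_trans _ (vC 0%N)) ?nnorm_ge0.
have [n0 h] := rho_small C0 eps0; exists n0 => n /h lt_eps.
rewrite uE addrAC subrr add0r nnormM_pX (le_trans _ (ltW lt_eps))//.
by rewrite ler_wpM2l ?exprn_ge0 ?padic_abs_ge0.
Qed.

End Norm.

(** * Bernoulli polynomials and sums of powers *)

Section Bernoulli.
Implicit Types (x : rat) (k h : nat).

Lemma bern_poly_rec k : k.+1%:R *: bern_poly k =
  k.+1%:R *: 'X^k - \sum_(i < k) ('C(k.+1, i))%:R *: bern_poly i.
Proof.
rewrite {1}/bern_poly /= nth_rcons size_bern_polys ltnn eqxx.
rewrite scalerBr scalerA divff ?pnatr_eq0// scale1r; congr (_ - _).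
by apply: eq_bigr => i _; rewrite bern_polys_nth.
Qed.

Let binS_mul k i : ('C(k.+1, i.+1))%:R * i.+1%:R = k.+1%:R * ('C(k, i))%:R :> rat.
Proof. by rewrite -!natrM mulnC -mul_bin_diag. Qed.

(** The recursions satisfied by the derivative and by the difference of
    [bern_poly k] are those of [k * bern_poly k.-1] and of [k * 'X^(k.-1)],
    because [i * 'C(k.+1, i) = k.+1 * 'C(k, i.-1)]. *)
Lemma deriv_bern_poly k : (bern_poly k.+1)^`() = k.+1%:R *: bern_poly k.
Proof.
elim/ltn_ind: k => k IH.
have k2 : k.+2%:R != 0 :> rat by rewrite pnatr_eq0.
apply: (scalerI k2); rewrite -derivZ (bern_poly_rec k.+1) derivB derivZ derivXn.
rewrite raddf_sum /= big_ord_recl /=.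
rewrite derivZ; have -> : (bern_poly 0)^`() = 0.
  by rewrite /bern_poly /= big_ord0 scaler0 subr0 expr0 derivC.
rewrite scaler0 add0r.
rewrite (eq_bigr (fun i : 'I_k => k.+2%:R *: (('C(k.+1, i))%:R *: bern_poly i))).
  rewrite -scaler_sumr -scalerBr bern_poly_rec -scaler_nat.
  by [].
move=> i _; rewrite /bump leq0n add1n derivZ (IH i)//.
by rewrite [LHS]scalerA [RHS]scalerA binS_mul.
Qed.

Lemma bern_poly_diff k x :
  (bern_poly k).[x + 1] - (bern_poly k).[x] = k%:R * x ^+ k.-1.
Proof.
elim/ltn_ind: k => k IH.
have k1 : k.+1%:R != 0 :> rat by rewrite pnatr_eq0.
apply: (mulfI k1); rewrite mulrBr -!hornerZ bern_poly_rec.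
rewrite !hornerD !hornerN !hornerZ !hornerXn !horner_sum.
have regroup (a b s t : rat) : a - s - (b - t) = a - b - (s - t) by ring.
rewrite regroup -sumrB.
rewrite (eq_bigr (fun i : 'I_k => ('C(k.+1, i))%:R * (i%:R * x ^+ i.-1))); last first.
  by move=> i _; rewrite !hornerZ -mulrBr IH.
case: k {IH k1} => [|k]; first by rewrite big_ord0 !expr0 subr0 mul0r mulr0 subrr.
rewrite big_ord_recl /= mul0r mulr0 add0r.
rewrite (eq_bigr (fun i : 'I_k => k.+2%:R * (('C(k.+1, i))%:R * x ^+ i))); last first.
  by move=> i _; rewrite /bump /= add1n mulrA binS_mul mulrA.
rewrite -mulr_sumr -!mulrBr; congr (_ * _).
rewrite [x + 1]addrC exprDn !big_ord_recr /= !expr1n !mul1r binn mulr1n.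
rewrite binSn [X in X + _ + _ - _ - _](eq_bigr
  (fun i : 'I_k => ('C(k.+1, i))%:R * x ^+ i)) => [|i _].
  by rewrite -mulr_natl; ring.
by rewrite expr1n mul1r mulr_natl.
Qed.

Lemma sum_powers_bern k x h : k.+1%:R * \sum_(i < h) (x + i%:R) ^+ k =
  (bern_poly k.+1).[x + h%:R] - (bern_poly k.+1).[x].
Proof.
elim: h => [|h IH]; first by rewrite big_ord0 addr0 subrr mulr0.
rewrite big_ord_recr /= mulrDr IH; have := bern_poly_diff k.+1 (x + h%:R) => /= <-.
by rewrite -[h.+1%:R]natr1 [x + (_ + _)]addrA; ring.
Qed.

(** The left-hand side telescopes to a difference of values of
    [bern_poly k.+1] at [x + h] and [x]; expand it at x, using
    [deriv_bern_poly] for the linear term. *)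
Lemma sum_powers_second_order k x : exists Q : {poly rat}, forall h,
  \sum_(i < h) (x + i%:R) ^+ k = h%:R * (bern_poly k).[x] + h%:R ^+ 2 * Q.[h%:R].
Proof.
have k1 : k.+1%:R != 0 :> rat by rewrite pnatr_eq0.
pose G := bern_poly k.+1 \Po ('X + x%:P).
exists (k.+1%:R^-1 *: drop_poly 2 G) => h.
apply: (mulfI k1); rewrite sum_powers_bern.
have -> : (bern_poly k.+1).[x + h%:R] = G.[h%:R].
  by rewrite horner_comp !hornerE addrC.
rewrite -[in LHS](poly_take_drop 2 G) hornerD hornerM hornerXn.
rewrite hornerZ mulrDr [k.+1%:R * (_ ^+ 2 * _)]mulrCA mulVKf//.
rewrite addrAC [X in _ = _ + X]mulrC; congr (_ + _).
have G0 : G`_0 = (bern_poly k.+1).[x].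
  by rewrite -horner_coef0 horner_comp !hornerE.
have G1 : G`_1 = k.+1%:R * (bern_poly k).[x].
  rewrite -[G`_1]mulr1n -[LHS]/(G`_0.+1 *+ 0.+1) -coef_deriv -horner_coef0.
  rewrite deriv_comp derivD derivX derivC addr0 mulr1 deriv_bern_poly.
  by rewrite horner_comp !hornerE.
rewrite /take_poly horner_poly !big_ord_recr big_ord0 /= G0 G1.
by rewrite expr0 expr1; ring.
Qed.

End Bernoulli.

(** * The Bernoulli distribution *)

Section BernoulliDistribution.
Variables (p : nat) (p_pr : prime p) (d c : nat).
Hypotheses (d_gt0 : (0 < d)%N) (cop_dc : coprime d c) (cop_cp : coprime c p).
Notation M n := (d * p ^ n)%N.

Let p_gt1 := prime_gt1 p_pr.
Let p_gt0 := prime_gt0 p_pr.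

Lemma level_gt0 n : (0 < M n)%N.
Proof. by rewrite muln_gt0 d_gt0 expn_gt0 p_gt0. Qed.

Lemma levelS n : (M n.+1 = p * M n)%N.
Proof. by rewrite expnS mulnCA. Qed.

Definition inv_c (n : nat) : nat := (c%:R^-1 : 'Z_(d * p ^ (2 * n + 1))).

(** The residue of a / c modulo d * p ^ n. *)
Definition divc (n a : nat) : nat := (inv_c n * a %% M n)%N.

Lemma coprime_c_level n : coprime c (M n).
Proof. by rewrite coprimeMr coprime_sym cop_dc coprimeXr. Qed.

Lemma divc_lt n a : (divc n a < M n)%N.
Proof. by rewrite ltn_mod level_gt0. Qed.

Lemma inv_cK n : (c * inv_c n = 1 %[mod M n])%N.
Proof.
rewrite /inv_c; set P := (d * p ^ (2 * n + 1))%N.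
have P1 : (1 < P)%N.
  rewrite /P addn1 levelS (leq_trans p_gt1)// leq_pmulr//.
  exact: level_gt0.
have MP : (M n %| P)%N by rewrite dvdn_mul// dvdn_exp2l//; lia.
suff e : (c * ((c%:R^-1 : 'Z_P) : nat) = 1 %[mod P])%N.
  by rewrite -(modn_dvdm _ MP) e modn_dvdm.
have cu : (c%:R : 'Z_P) \is a GRing.unit.
  by rewrite unitZpE// coprime_sym coprime_c_level.
by rewrite -!(val_Zp_nat P1) natrM [_%:R in X in _ * X]natr_Zp mulrV.
Qed.

Lemma divcK n a : (c * divc n a = a %[mod M n])%N.
Proof. by rewrite /divc modnMmr mulnA -modnMml inv_cK modnMml mul1n. Qed.

Lemma divc_unique n a b : (b < M n)%N -> (c * b = a %[mod M n])%N -> divc n a = b.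
Proof.
move=> bM cb; rewrite /divc -modnMmr -cb modnMmr mulnA [(_ * c)%N]mulnC.
by rewrite -modnMml inv_cK modnMml mul1n modn_small.
Qed.

Lemma divc_small n a : (a < M n)%N -> exists q, (c * divc n a = a + q * M n)%N.
Proof.
move=> aM; exists (c * divc n a %/ M n)%N.
by rewrite {1}(divn_eq (c * divc n a) (M n)) divcK modn_small// addnC.
Qed.

Lemma frac_part_nat (a N : nat) : (0 < N)%N ->
  frac_part (a%:R / N%:R) = (a %% N)%:R / N%:R.
Proof.
move=> N0; have N0' : (0 : rat) < N%:R by rewrite ltr0n.
have N_neq0 := lt0r_neq0 N0'.
rewrite /frac_part {1}(divn_eq a N) natrD natrM mulrDl mulfK//.
suff -> : Num.floor (a%:R / N%:R : rat) = (a %/ N)%N.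
  by rewrite -pmulrn addrAC subrr add0r.
apply: floor_def.
rewrite -!pmulrn ler_pdivlMr// -natrM ler_nat leq_trunc_div /=.
by rewrite ltr_pdivrMr// addn1 -natrM ltr_nat ltn_ceil.
Qed.

Lemma bern_dist_divc n a : (a < M n)%N ->
  bern_dist p d c n a =
  a%:R / (M n)%:R - c%:R * ((divc n a)%:R / (M n)%:R) + (c%:R - 1) / 2.
Proof.
move=> aM; rewrite /bern_dist !frac_part_nat ?level_gt0//.
by rewrite modn_small.
Qed.

Let level_neq0 n : (M n)%:R != 0 :> rat.
Proof. by rewrite pnatr_eq0 -lt0n level_gt0. Qed.

Lemma bern_dist_quo n a q : (a < M n)%N -> (c * divc n a = a + q * M n)%N ->
  bern_dist p d c n a = - q%:R + (c%:R - 1) / 2.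
Proof.
move=> aM e; rewrite bern_dist_divc//; congr (_ + _).
rewrite mulrA -natrM e natrD [(q * _)%N%:R]natrM mulrDl mulfK//.
by rewrite opprD addrA subrr add0r.
Qed.

Lemma lift_level_lt n a j : (a < M n)%N -> (j < p)%N -> (a + j * M n < M n.+1)%N.
Proof.
move=> aM jp; rewrite levelS (@leq_trans (j.+1 * M n))//.
  by rewrite [leqRHS]mulSn ltn_add2r.
by rewrite leq_mul2r jp orbT.
Qed.

Lemma divc_lift n a j : (a < M n)%N -> (j < p)%N ->
  exists2 k, (k < p)%N & divc n.+1 (a + j * M n) = (divc n a + k * M n)%N.
Proof.
move=> aM jp; have lt := divc_lt n.+1 (a + j * M n).
exists (divc n.+1 (a + j * M n) %/ M n)%N.
  by rewrite ltn_divLR ?level_gt0// -levelS.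
rewrite [LHS](divn_eq _ (M n)) [LHS]addnC; congr (_ + _)%N; apply/esym.
apply: divc_unique; first by rewrite ltn_mod level_gt0.
have dvdM : (M n %| M n.+1)%N by rewrite dvdn_mul// dvdn_exp2l.
rewrite modnMmr -(modn_dvdm _ dvdM) divcK modn_dvdm//.
by rewrite addnC modnMDl.
Qed.

(** Above a, division by c permutes the p lifts of [divc n a]. *)
Lemma sum_divc_lift n a : (a < M n)%N ->
  (\sum_(j < p) divc n.+1 (a + j * M n) = \sum_(j < p) (divc n a + j * M n))%N.
Proof.
move=> aM.
pose s (j : 'I_p) : 'I_p := insubd j (divc n.+1 (a + j * M n) %/ M n)%N.
have sE (j : 'I_p) : divc n.+1 (a + j * M n) = (divc n a + s j * M n)%N.
  have [k kp e] := divc_lift aM (ltn_ord j).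
  rewrite e /s val_insubd e addnC divnMDl ?level_gt0// divn_small ?divc_lt// addn0.
  by rewrite kp addnC.
have s_inj : injective s.
  move=> i j ij; have := divcK n.+1 (a + i * M n).
  rewrite sE ij -sE divcK => /eqP; rewrite !modn_small ?lift_level_lt//.
  by rewrite eqn_add2l eqn_pmul2r ?level_gt0// => /eqP/val_inj ->.
rewrite (eq_bigr _ (fun j _ => sE j)).
by rewrite [RHS](reindex_inj s_inj).
Qed.

(** Additivity of the distribution.  The p lifts of a and those of [divc n a]
    add (p - 1) / 2 to their fractional parts, and
    (1 - c) * (p - 1) / 2 + p * (c - 1) / 2 = (c - 1) / 2. *)
Lemma bern_dist_fiber n a : (a < M n)%N ->
  \sum_(j < p) bern_dist p d c n.+1 (a + j * M n) = bern_dist p d c n a.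
Proof.
move=> aM.
under eq_bigr => j _ do rewrite bern_dist_divc ?lift_level_lt//.
rewrite big_split sumrB /= -mulr_sumr -!mulr_suml -!natr_sum sum_divc_lift//.
rewrite sumr_const card_ord bern_dist_divc//.
rewrite !big_split /= !sum_nat_const !card_ord !natrD ![(p * _)%N%:R]natrM.
have -> : (\sum_(i < p) i * M n)%N%:R = p%:R * (p%:R - 1) / 2 * (M n)%:R :> rat.
  have sum_id k : \sum_(i < k) (i%:R : rat) = k%:R * (k%:R - 1) / 2.
    elim: k => [|k IH]; first by rewrite big_ord0 !mul0r.
    by rewrite big_ord_recr /= IH -natr1; field.
  rewrite natr_sum -sum_id mulr_suml.
  by apply: eq_bigr => i _; rewrite [LHS]natrM.
rewrite levelS [(p * M n)%N%:R]natrM -mulr_natr.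
have p0 : p%:R != 0 :> rat by rewrite pnatr_eq0 -lt0n.
have := level_neq0 n; move: (M n)%:R => X X0.
by field; rewrite X0 p0.
Qed.

End BernoulliDistribution.

(** * Continuous functions on (Z/d)^* x Zp^* *)

Local Open Scope classical_set_scope.

(** Every neighbourhood of s contains the preimage of an open set around f s. *)
Lemma cvg_initial (S : choiceType) (T : topologicalType) (f : S -> T)
    (F : set_system S) (s : S) : Filter F ->
  f @ F --> f s -> F --> (s : initial_topology f).
Proof.
move=> FF cvfF A /= [_ [[B Bop <-] Bfs sBfA]].
have FB : F (f @^-1` B) by apply: cvfF; exact: open_nbhs_nbhs.
exact: filterS sBfA FB.
Qed.

Section WeightDomain.
Variables (p : nat) (p_pr : prime p) (d : nat).
Notation Zp := (padicInt p_pr).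
Notation X := (weightDomain p_pr d).

Lemma padicUnit_ex (z : Zp) : z \is a GRing.unit ->
  exists u : padicUnit p_pr, val u = z.
Proof.
move=> zu; have zA : z \in [set x : Zp | x \is a GRing.unit] by exact: mem_set.
by exists (SigSub zA).
Qed.

Lemma padicUnitP (u : padicUnit p_pr) : zmod (val u) 1 != 0%N.
Proof. by rewrite -padic_unitE; exact: (set_valP u). Qed.

(** The classes of this relation are the basic open sets of level n of X. *)
Definition same_cyl (n : nat) (x y : X) : Prop :=
  x.1 = y.1 /\ zmod (val x.2) n = zmod (val y.2) n.

Lemma same_cyl_sym n x y : same_cyl n x y -> same_cyl n y x.
Proof. by move=> []. Qed.

Lemma same_cyl_trans n x y z : same_cyl n x y -> same_cyl n y z -> same_cyl n x z.
Proof. by rewrite /same_cyl => -[-> ->] []. Qed.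

Lemma same_cyl_le k n x y : (k <= n)%N -> same_cyl n x y -> same_cyl k x y.
Proof.
by rewrite /same_cyl => kn [-> xy]; split=> //; rewrite -(zmod_le _ kn) xy zmod_le.
Qed.

Lemma nbhs_same_cyl n (x : X) : \forall y \near x, same_cyl n x y.
Proof.
exists ([set x.1], [set u : padicUnit p_pr | zmod (val u) n = zmod (val x.2) n]).
  split=> /=; first exact: discrete_set1.
  have zc : continuous (fun z : Zp => zmod z n).
    move=> z; have := @initial_continuous Zp {ptws nat -> nat} (@zmod p p_pr) z.
    move=> zmod_cvg.
    have h : {ptws, (@zmod p p_pr @ nbhs z) --> zmod z} := zmod_cvg.
    exact: ((pointwise_cvgP _ _).1 h n).
  have vc : continuous (val : padicUnit p_pr -> Zp) by exact: initial_continuous.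
  have := continuous_comp (vc x.2) (zc _).
  by move=> /(_ [set k | k = zmod (val x.2) n]); apply; exact: discrete_set1.
by move=> [u v] /= [-> e]; split=> //; exact: esym e.
Qed.

Lemma same_cyl_cvg (xs : nat -> X) (x : X) :
  (forall n, same_cyl n (xs n) x) -> xs n @[n --> \oo] --> x.
Proof.
move=> xsx.
have cvg1 : (xs n).1 @[n --> \oo] --> x.1.
  move=> A /nbhs_singleton Ax; exists 0%N => // n _ /=.
  by have [-> _] := xsx n.
have cvg2 : (xs n).2 @[n --> \oo] --> x.2.
  apply: cvg_initial; apply: cvg_initial.
  apply/pointwise_cvgP => k A /nbhs_singleton Ax.
  by exists k => // n /= kn; have [_ ->] := same_cyl_le kn (xsx n).
have -> : xs = fun n => ((xs n).1, (xs n).2).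
  by apply/funext => n; case: (xs n).
rewrite [x]surjective_pairing.
exact: (@cvg_pair _ _ _ \oo (nbhs x.1) (nbhs x.2) _ _ _ _ _ cvg1 cvg2).
Qed.

(** The residues of [z n] modulo p ^ n are coherent, so they define a p-adic
    integer, and already the first one decides that it is a unit. *)
Lemma same_cyl_limit (z : nat -> X) :
  (forall n, same_cyl n (z n) (z n.+1)) -> exists x, forall n, same_cyl n (z n) x.
Proof.
move=> zz.
pose x2 := @PadicInt p p_pr (fun n => zmod (val (z n).2) n)
  (fun n => etrans (zmod_coherent _ n) (esym (zz n).2)).
have [u uE] : exists u : padicUnit p_pr, val u = x2.
  by apply: padicUnit_ex; rewrite padic_unitE; exact: padicUnitP.
exists ((z 0%N).1, u) => n; split=> /=; last by rewrite uE.
by elim: n => // n <-; have [-> _] := zz n.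
Qed.

End WeightDomain.

(** Otherwise each t fails at some k; take the largest of these k. *)
Lemma finite_pigeonhole (T : finType) (P : T -> nat -> Prop) :
  (forall t j k, (j <= k)%N -> P t k -> P t j) ->
  (forall k, exists t, P t k) -> exists t, forall k, P t k.
Proof.
move=> Pdec Pex; apply: contrapT => H.
have /choice[k kP] : forall t, exists k, ~ P t k.
  move=> t; apply: contrapT => Ht; apply: H; exists t => k.
  by apply: contrapT => Pk; apply: Ht; exists k.
have [t Pt] := Pex (\max_t k t)%N.
by apply: (kP t); apply: Pdec Pt; exact: leq_bigmax.
Qed.

Section UniformContinuity.
Variables (p : nat) (p_pr : prime p) (K : realType).
Variable R : completeNonArchAlgType K p_pr.
Variable d : nat.
Notation X := (weightDomain p_pr d).

Definition oscillation_le (f : X -> R) (n : nat) (eps : K) : Prop :=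
  forall x y, same_cyl n x y -> nnorm (f x - f y) <= eps.

(** X is compact.  If f oscillates by more than eps on some cylinder of each
    level, then by pigeonhole some cylinder of level n contains such cylinders
    of all levels, and inside it some cylinder of level n + 1; f is not
    continuous at the intersection of these nested cylinders. *)
Lemma uniformly_continuous (f : X -> R) : continuous f ->
  forall eps : K, 0 < eps -> exists n, oscillation_le f n eps.
Proof.
move=> fc eps eps0; apply: contrapT => nosc.
pose bad k x y := same_cyl k x y /\ ~ (nnorm (f x - f y) <= eps).
have bad_le j k x y : (j <= k)%N -> bad k x y -> bad j x y.
  by move=> jk [xy b]; split=> //; exact: same_cyl_le xy.
have bad_ex k : exists x y, bad k x y.
  apply: contrapT => H; apply: nosc; exists k => x y xy.
  by apply: contrapT => b; apply: H; exists x, y.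
pose hopeless n z := forall k, exists x y, same_cyl n z x /\ bad k x y.
have [z0 hz0] : exists z, hopeless 0%N z.
  have [|k|u Pu] := @finite_pigeonhole {unit 'Z_d}
    (fun u k => exists x y, x.1 = u /\ bad k x y).
  - move=> u j k jk [x [y [xu b]]]; exists x, y; split=> //.
    exact: bad_le b.
  - by have [x [y b]] := bad_ex k; exists x.1, x, y.
  have [x [y [xu _]]] := Pu 0%N; exists x => k.
  have [x' [y' [xu' b]]] := Pu k; exists x', y'; split=> //.
  split; first by rewrite xu xu'.
  have z0 (w : padicInt p_pr) : zmod w 0 = 0%N.
    by have := zmod_lt w 0; case: (zmod w 0).
  by rewrite !z0.
have step n z : hopeless n z -> exists z', same_cyl n z z' /\ hopeless n.+1 z'.
  move=> hz.
  have [|k|t Pt] := @finite_pigeonhole 'I_(p ^ n.+1) (fun t k =>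
    exists x y, [/\ same_cyl n z x, zmod (val x.2) n.+1 = t & bad k x y]).
  - move=> t j k jk [x [y [zx xt b]]]; exists x, y; split=> //.
    exact: bad_le b.
  - have [x [y [zx b]]] := hz k.
    by exists (Ordinal (zmod_lt (val x.2) n.+1)), x, y.
  have [x [y [zx xt _]]] := Pt 0%N; exists x; split=> // k.
  have [x' [y' [zx' xt' b]]] := Pt k; exists x', y'; split=> //.
  split; last by rewrite xt xt'.
  by have [<- _] := zx; have [<- _] := zx'.
have [g gP] : exists g : nat -> X -> X, forall n z, hopeless n z ->
    same_cyl n z (g n z) /\ hopeless n.+1 (g n z).
  have /choice[g gP] : forall nz : nat * X, exists z', hopeless nz.1 nz.2 ->
      same_cyl nz.1 nz.2 z' /\ hopeless nz.1.+1 z'.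
    move=> [n z] /=; have [/step[z' h]|h] := pselect (hopeless n z).
      by exists z'.
    by exists z.
  by exists (fun n z => g (n, z)) => n z; exact: (gP (n, z)).
pose z := fix z n := if n is m.+1 then g m (z m) else z0.
have hz n : hopeless n (z n).
  by elim: n => //= n IH; have [] := gP _ _ IH.
have [x xP] := same_cyl_limit (fun n => proj1 (gP _ _ (hz n)) :
  same_cyl n (z n) (z n.+1)).
have /choice[xy xyP] : forall n, exists xy : X * X,
    same_cyl n (z n) xy.1 /\ bad n xy.1 xy.2.
  by move=> n; have [x1 [y1 h]] := hz n n; exists (x1, y1).
have cx : f (xy n).1 @[n --> \oo] --> f x.
  suff s1 : (xy n).1 @[n --> \oo] --> x by exact: cvg_comp s1 (fc x).
  apply: same_cyl_cvg => n.
  by have [/same_cyl_sym h _] := xyP n; exact: same_cyl_trans h (xP n).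
have cy : f (xy n).2 @[n --> \oo] --> f x.
  suff s2 : (xy n).2 @[n --> \oo] --> x by exact: cvg_comp s2 (fc x).
  apply: same_cyl_cvg => n.
  have [/same_cyl_sym h [/same_cyl_sym h' _]] := xyP n.
  exact: same_cyl_trans h' (same_cyl_trans h (xP n)).
have [n1 c1] := (nnorm_cvgP _ _).1 cx _ eps0.
have [n2 c2] := (nnorm_cvgP _ _).1 cy _ eps0.
have [_ [_]] := xyP (n1 + n2)%N; apply.
rewrite -(subrK (f x) (f _)) -addrA nnormD_le// ?c1 ?leq_addr//.
by rewrite nnormB c2// leq_addl.
Qed.

Lemma oscillation_continuous (f : X -> R) :
  (forall eps : K, 0 < eps -> exists n, oscillation_le f n eps) -> continuous f.
Proof.
move=> H x; apply/metricType_numDomainType.cvgrPdist_le => eps eps0.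
have [n h] := H _ eps0; near=> y; rewrite mdist_nnorm h//.
by near: y; exact: nbhs_same_cyl.
Unshelve. all: by end_near. Qed.

(** Evaluate f at the residue modulo p ^ n of the p-adic coordinate, which is
    still a unit since n is positive. *)
Lemma locally_constant_approx (f : X -> R) n (eps : K) : (0 < n)%N ->
  oscillation_le f n eps ->
  exists2 g, locally_constant g & forall x, nnorm (f x - g x) <= eps.
Proof.
move=> n0 fosc.
have rep (u : padicUnit p_pr) : exists v : padicUnit p_pr,
    val v = (zmod (val u) n)%:R :> padicInt p_pr.
  apply: padicUnit_ex; rewrite padic_unitE zmod_nat expn1 zmod_small_level//.
  exact: padicUnitP.
have /choice[r rE] := rep.
exists (fun x => f (x.1, r x.2)).
  move=> x; near=> y.
  have [<- yx] : same_cyl n x y by near: y; exact: nbhs_same_cyl.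
  by congr (f (_, _)); apply: val_inj; rewrite !rE yx.
move=> x; apply: fosc; split=> //=.
by rewrite rE zmod_nat modn_small// zmod_lt.
Unshelve. all: by end_near. Qed.

End UniformContinuity.

(** * The Bernoulli measure *)

Lemma sum_residues (V : nmodType) (G : nat -> V) (h f : nat) :
  \sum_(i < h * f) G i = \sum_(r < f) \sum_(j < h) G (r + j * f)%N.
Proof.
elim: h => [|h IH].
  by rewrite mul0n big_ord0 big1// => r _; rewrite big_ord0.
rewrite -(big_mkord xpredT G) mulSnr big_mkord big_split_ord /= IH.
under [RHS]eq_bigr => r _ do rewrite big_ord_recr /=.
rewrite big_split /=; congr (_ + _).
by apply: eq_bigr => r _; rewrite addnC.
Qed.

Section BernoulliMeasure.
Variables (p : nat) (p_pr : prime p) (K : realType).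
Variable R : completeNonArchAlgType K p_pr.
Variables (d c : nat).
Hypotheses (d_gt0 : (0 < d)%N) (cop_dc : coprime d c) (cop_cp : coprime c p).
Notation Zp := (padicInt p_pr).
Notation X := (weightDomain p_pr d).
Notation M n := (d * p ^ n)%N.
Implicit Types f g : X -> R.

Let p_gt0 := prime_gt0 p_pr.

Lemma padic_natr_unit a : ((a%:R : Zp) \is a GRing.unit) = coprime a p.
Proof.
by rewrite padic_unitE zmod_nat expn1 coprime_sym prime_coprime.
Qed.

Lemma padicUnit_mem a :
  ((a%:R : Zp) \in [set x : Zp | x \is a GRing.unit]) = coprime a p.
Proof.
by rewrite -padic_natr_unit; apply/idP/idP => [/set_mem|/mem_set].
Qed.

Lemma ext0_coprime f a : coprime a p -> coprime a d ->
  exists2 u : padicUnit p_pr, val u = a%:R & ext0 f a = f (toUnit d a, u).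
Proof.
move=> ap ad; rewrite /ext0; case: insubP => [u _ ua|].
  by exists u; rewrite ?ad.
by rewrite padicUnit_mem ap.
Qed.

Lemma ext0_eq0 f a : ~~ (coprime a p && coprime a d) -> ext0 f a = 0.
Proof.
rewrite /ext0; case: insubP => [u + _|//].
by rewrite padicUnit_mem => -> /= /negbTE ->.
Qed.

Lemma ext0_osc f n (eps : K) a b : 0 <= eps -> (0 < n)%N ->
  oscillation_le f n eps -> a = b %[mod M n] -> nnorm (ext0 f a - ext0 f b) <= eps.
Proof.
move=> eps0 n0 fosc ab.
have modD N : (N %| M n)%N -> a = b %[mod N].
  by move=> NM; rewrite -(modn_dvdm a NM) ab modn_dvdm.
have abp : coprime a p = coprime b p.
  by rewrite -coprime_modl modD ?coprime_modl// dvdn_mull// dvdn_exp.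
have abd : coprime a d = coprime b d.
  by rewrite -coprime_modl modD ?coprime_modl// dvdn_mulr.
have [/andP[ap ad]|h] := boolP (coprime a p && coprime a d); last first.
  by rewrite !ext0_eq0 -?abp -?abd// subr0 nnorm0.
have [u ua ->] := ext0_coprime f ap ad.
rewrite abp in ap; rewrite abd in ad.
have [v vb ->] := ext0_coprime f ap ad.
apply: fosc; split=> /=; first by apply: toUnit_mod => //; rewrite modD// dvdn_mulr.
by rewrite ua vb !zmod_nat; apply: modD; rewrite dvdn_mull.
Qed.

Definition dist_bound : K :=
  Num.max (nnorm (1 : R)) (nnorm (ofrat R ((c%:R - 1) / 2))).

Lemma dist_bound_gt0 : 0 < dist_bound.
Proof. by rewrite /dist_bound lt_max nnorm1_gt0. Qed.

Lemma bern_dist_bound n a : (a < M n)%N ->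
  nnorm (ofrat R (bern_dist p d c n a)) <= dist_bound.
Proof.
move=> aM; have [q qE] := divc_small p_pr d_gt0 cop_dc cop_cp aM.
rewrite (bern_dist_quo p_pr d_gt0 aM qE) rmorphD rmorphN rmorph_nat /=.
by rewrite nnormD_le ?nnormN// /dist_bound le_max ?nnorm_natr ?lexx ?orbT.
Qed.

(** By additivity the sum of level n is a sum of level n.+1 with f evaluated
    modulo p ^ n. *)
Lemma bern_sum_step f n (eps : K) : 0 <= eps -> (0 < n)%N ->
  oscillation_le f n eps ->
  nnorm (bern_sum c f n.+1 - bern_sum c f n) <= eps * dist_bound.
Proof.
move=> eps0 n0 fosc.
have C0 : 0 <= eps * dist_bound by rewrite mulr_ge0// ltW// dist_bound_gt0.
have -> : bern_sum c f n.+1 = \sum_(a < M n) \sum_(j < p)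
    ext0 f (a + j * M n) * ofrat R (bern_dist p d c n.+1 (a + j * M n)).
  pose G a := ext0 f a * ofrat R (bern_dist p d c n.+1 a).
  rewrite /bern_sum -(big_mkord xpredT G) levelS big_mkord.
  exact: sum_residues G p (M n).
rewrite /bern_sum -sumrB nnorm_sum_le// => a _.
rewrite -(bern_dist_fiber p_pr d_gt0 cop_dc cop_cp (ltn_ord a)).
rewrite rmorph_sum mulr_sumr -sumrB nnorm_sum_le// => j _.
rewrite -mulrBl nnormM_le_bound ?bern_dist_bound//.
  by apply: (ext0_osc eps0 n0 fosc); rewrite addnC modnMDl.
by rewrite lift_level_lt.
Qed.

Lemma bern_sum_close f g (eps : K) n : 0 <= eps ->
  (forall x, nnorm (f x - g x) <= eps) ->
  nnorm (bern_sum c f n - bern_sum c g n) <= eps * dist_bound.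
Proof.
move=> eps0 fg.
have C0 : 0 <= eps * dist_bound by rewrite mulr_ge0// ltW// dist_bound_gt0.
rewrite /bern_sum -sumrB nnorm_sum_le// => a _.
rewrite -mulrBl nnormM_le_bound ?bern_dist_bound//.
rewrite /ext0; case: insubP => [u _ _|_]; last by rewrite subr0 nnorm0.
by case: ifP => _; rewrite ?subr0 ?nnorm0.
Qed.

Lemma bern_sum_cvg f : continuous f -> bern_sum c f n @[n --> \oo] --> bern_locconst c f.
Proof.
move=> fc; suff [l fl] : exists l : R, bern_sum c f n @[n --> \oo] --> l.
  by rewrite /bern_locconst (nnorm_lim fl).
apply: nnorm_cauchy => eps eps0.
have eps'0 : 0 < eps / dist_bound by rewrite divr_gt0// dist_bound_gt0.
have [k kf] := uniformly_continuous fc eps'0.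
exists k.+1 => n kn; rewrite -[leRHS](divfK (lt0r_neq0 dist_bound_gt0)).
rewrite bern_sum_step ?(ltW eps'0)//; first exact: leq_trans kn.
by move=> x y xy; apply: kf; apply: same_cyl_le xy; exact: ltnW.
Qed.

Lemma nnorm_lim_close (u v : nat -> R) (k l : R) (C : K) :
  u n @[n --> \oo] --> k -> v n @[n --> \oo] --> l ->
  (forall n, nnorm (u n - v n) <= C) -> nnorm (k - l) <= C.
Proof.
move=> /nnorm_cvgP uk /nnorm_cvgP vl uv; rewrite leNgt; apply/negP => Clt.
have C0 : 0 <= C by rewrite (le_trans _ (uv 0%N)) ?nnorm_ge0.
have e0 : 0 < nnorm (k - l) by exact: le_lt_trans Clt.
have e20 : 0 < nnorm (k - l) / 2 by rewrite divr_gt0.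
have e2_lt : nnorm (k - l) / 2 < nnorm (k - l).
  by rewrite ltr_pdivrMr// ltr_pMr// ltr1n.
have [n1 h1] := uk _ e20; have [n2 h2] := vl _ e20.
have {h1}h1 := h1 _ (leq_addr n2 n1); have {h2}h2 := h2 _ (leq_addl n1 n2).
rewrite nnormB in h1.
have : nnorm (k - l) <= Num.max (nnorm (k - l) / 2) C.
  have e : k - l = (k - u (n1 + n2)%N) + ((u (n1 + n2)%N - v (n1 + n2)%N) +
    (v (n1 + n2)%N - l)) by ring.
  rewrite {1}e; apply: nnormD_le; first by rewrite le_max h1.
  by apply: nnormD_le; rewrite le_max ?uv ?h2 ?orbT.
by rewrite leNgt gt_max Clt e2_lt.
Qed.

Lemma bern_locconst_close f g (eps : K) : 0 <= eps ->
  continuous f -> continuous g -> (forall x, nnorm (f x - g x) <= eps) ->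
  nnorm (bern_locconst c f - bern_locconst c g) <= eps * dist_bound.
Proof.
move=> eps0 fc gc fg.
apply: nnorm_lim_close (bern_sum_cvg fc) (bern_sum_cvg gc) _ => n.
exact: bern_sum_close.
Qed.

Lemma locally_constant_continuous f : locally_constant f -> continuous f.
Proof.
move=> flc x A Ax; have := flc x; apply: filterS => y /= ->.
exact: nbhs_singleton Ax.
Qed.

(** The limit of the Riemann sums is itself a continuous extension, and any
    other one agrees with it by density of the locally constant functions. *)
Lemma bern_integral_lim f : continuous f ->
  bern_integral c f = bern_locconst c f.
Proof.
move=> fc; rewrite /bern_integral.
case: xgetP => [Phi _ [Phic Phi_lc]|/(_ (bern_locconst c))]; last first.
  case; split=> //; apply/subspace_continuousP => g /= gc.
  apply/metricType_numDomainType.cvgrPdist_le => eps eps0.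
  have eps'0 : 0 < eps / dist_bound by rewrite divr_gt0// dist_bound_gt0.
  rewrite near_withinE; apply/uniform_nbhs.
  exists [set xy | ball xy.1 (eps / dist_bound) xy.2]; split.
    by rewrite -entourage_ballE; exists (eps / dist_bound).
  move=> h /= gh hc; rewrite mdist_nnorm.
  rewrite -[leRHS](divfK (lt0r_neq0 dist_bound_gt0)).
  apply: bern_locconst_close => //; first exact: ltW.
  move=> x; have := gh x I; rewrite ballEmdist /= mdist_nnorm => /ltW.
  by [].
move/subspace_continuousP : Phic => /(_ f fc) Phif.
apply/eqP; rewrite -subr_eq0; apply/eqP/nnorm_eq0/eqP.
rewrite eq_le nnorm_ge0 andbT; apply/ler_addgt0Pl => eps eps0; rewrite addr0.
have FF : Filter (within [set f : {uniform X -> R} | continuous (f : X -> R)]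
  (nbhs (f : {uniform X -> R}))) by exact: within_filter.
have := metricType_numDomainType.cvgr_dist_le Phif eps0 => /(_ FF).
rewrite near_withinE => /uniform_nbhs[E []].
rewrite -entourage_ballE => -[/= del del0 delE] EPhi.
pose del' := Num.min (del / 2) (eps / dist_bound).
have del'0 : 0 < del'.
  by rewrite lt_min !divr_gt0// dist_bound_gt0.
have [k kf] := uniformly_continuous fc del'0.
have kf' : oscillation_le f k.+1 del'.
  by move=> x y xy; apply: kf; apply: same_cyl_le xy.
have [g glc fg] := locally_constant_approx (ltn0Sn k) kf'.
have gc := locally_constant_continuous glc.
have close : nnorm (Phi f - Phi g) <= eps.
  rewrite -mdist_nnorm; apply: (EPhi g _ gc) => x _; apply: delE => /=.
  rewrite ballEmdist /= mdist_nnorm (le_lt_trans (fg x))//.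
  rewrite (@le_lt_trans _ _ (del / 2)) ?ge_min ?lexx//.
  by rewrite ltr_pdivrMr// ltr_pMr// ltr1n.
rewrite (Phi_lc _ glc) in close.
have close' : nnorm (bern_locconst c f - bern_locconst c g) <= eps.
  rewrite (le_trans (bern_locconst_close (ltW del'0) fc gc fg))//.
  rewrite -[leRHS](divfK (lt0r_neq0 dist_bound_gt0)).
  by rewrite ler_wpM2r ?(ltW dist_bound_gt0)// ge_min lexx orbT.
rewrite -(subrK (bern_locconst c g) (Phi f)) -addrA nnormD_le//.
by rewrite nnormB.
Qed.

End BernoulliMeasure.

Local Close Scope classical_set_scope.

(** * Twisted power sums *)

Section TwistedPowerSums.
Variables (p : nat) (p_pr : prime p) (K : realType).
Variable R : completeNonArchAlgType K p_pr.
Notation rat_R := (ofrat R).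

(** In the application, e is a primitive Dirichlet character of conductor f
    extended by zero. *)
Variables (e : nat -> R) (f : nat).
Hypotheses (f_gt0 : (0 < f)%N).
Hypothesis e_mod : forall a b, a = b %[mod f] -> e a = e b.
Hypothesis eM : forall a b, e (a * b)%N = e a * e b.

Let p_gt0 := prime_gt0 p_pr.
Let f_neq0 : f%:R != 0 :> rat. Proof. by rewrite pnatr_eq0 -lt0n. Qed.

Lemma ofrat_natr n : rat_R n%:R = n%:R.
Proof. exact: rmorph_nat. Qed.

Lemma bounded_character : exists C, forall a, nnorm (e a) <= C.
Proof.
exists (\big[Num.max/0]_(r < f) nnorm (e r)) => a.
rewrite (@e_mod a (a %% f)) ?modn_mod//.
exact: (le_bigmax _ (fun r : 'I_f => nnorm (e r)) (Ordinal (ltn_pmod a f_gt0))).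
Qed.

Lemma bounded_ofrat_horner (Q : {poly rat}) : bounded_seq (fun h => rat_R Q.[h%:R]).
Proof.
have -> : (fun h => rat_R Q.[h%:R]) =
    (fun h => \sum_(i < size Q) rat_R Q`_i * (h ^ i)%N%:R).
  apply/funext => h; rewrite horner_coef rmorph_sum; apply: eq_bigr => i _.
  by rewrite rmorphM /= -natrX ofrat_natr.
apply: (@bounded_seq_sum_ord _ _ _ _ (fun i h => rat_R Q`_i * (h ^ i)%N%:R)) => i.
apply: bounded_seqM; first exact: bounded_seq_cst.
exact: bounded_seq_natr.
Qed.

Definition power_sum (k M : nat) : R := \sum_(a < M) e a * a%:R ^+ k.

Definition bernoulli_sum (k : nat) : R :=
  \sum_(r < f) e r * rat_R (bern_poly k).[r%:R / f%:R].

(** Apply [sum_powers_second_order] on each residue class r + j f modulo f. *)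
Lemma power_sum_expansion k : exists2 v, bounded_seq v & forall h,
  power_sum k (h * f) = h%:R * (f%:R ^+ k * bernoulli_sum k) + h%:R ^+ 2 * v h.
Proof.
have /choice[Q QE] := fun r : nat => sum_powers_second_order k (r%:R / f%:R).
exists (fun h => \sum_(r < f) (e r * f%:R ^+ k) * rat_R (Q r).[h%:R]).
  apply: (@bounded_seq_sum_ord _ _ _ _
    (fun r h => e r * f%:R ^+ k * rat_R (Q r).[h%:R])) => r.
  apply: bounded_seqM; first exact: bounded_seq_cst.
  exact: bounded_ofrat_horner.
move=> h; rewrite /power_sum.
rewrite (sum_residues (fun a => e a * a%:R ^+ k)) /bernoulli_sum !mulr_sumr -big_split /=.
apply: eq_bigr => r _.
rewrite (eq_bigr (fun j : 'I_h => e r * f%:R ^+ k * rat_R ((r%:R / f%:R + j%:R) ^+ k))).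
  rewrite -mulr_sumr -rmorph_sum QE rmorphD !rmorphM /= ?rmorphXn /= !ofrat_natr.
  by ring.
move=> j _; rewrite (@e_mod (r + j * f) r); last by rewrite addnC modnMDl.
rewrite -mulrA; congr (_ * _).
have -> : (r + j * f)%:R = rat_R (f%:R * (r%:R / f%:R + j%:R)).
  by rewrite mulrDr [f%:R * (_ / _)]mulrC divfK// -natrM -natrD ofrat_natr mulnC.
by rewrite rmorphM /= ofrat_natr exprMn rmorphXn.
Qed.

(** The p-stabilization of e: its values at the multiples of p are removed. *)
Definition prime_to_p (a : nat) : R := if coprime a p then e a else 0.

Definition power_sum_unit (k M : nat) : R := \sum_(a < M) prime_to_p a * a%:R ^+ k.

(** By multiplicativity the term at a = p * b is e p * p ^ k times the one at b. *)
Lemma power_sum_unitE k M : power_sum_unit k (p * M) =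
  power_sum k (p * M) - e p * p%:R ^+ k * power_sum k M.
Proof.
suff H : power_sum k (p * M) - power_sum_unit k (p * M) =
    e p * p%:R ^+ k * power_sum k M by rewrite -H; ring.
rewrite /power_sum /power_sum_unit -sumrB mulnC.
rewrite (sum_residues (fun a => e a * a%:R ^+ k - prime_to_p a * a%:R ^+ k)).
rewrite (bigD1 (Ordinal p_gt0)) //= [X in _ + X]big1 => [|r r0]; last first.
  rewrite big1// => j _; rewrite /prime_to_p.
  have -> : coprime (r + j * p) p.
    rewrite -coprime_modl addnC modnMDl coprime_modl coprime_sym prime_coprime//.
    by rewrite gtnNdvd// lt0n; apply: contra r0 => /eqP r0; apply/eqP/val_inj.
  by rewrite subrr.
rewrite addr0 mulr_sumr; apply: eq_bigr => j _.
rewrite add0n /prime_to_p coprimeMl [coprime p p]/coprime gcdnn.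
rewrite (gtn_eqF (prime_gt1 p_pr)) andbF mul0r subr0 mulnC eM natrM exprMn.
by ring.
Qed.

Section Riemann.
Variables (d c : nat).
Hypotheses (d_gt0 : (0 < d)%N) (cop_dc : coprime d c) (cop_cp : coprime c p).
Notation M n := (d * p ^ n)%N.
Notation kappa := (rat_R ((c%:R - 1) / 2)).

(** With b = [divc n a] and c b = a + q * M n the distribution takes the value
    - q + kappa; multiples of (q * M n) ^ 2 are collected in s. *)
Lemma bern_sum_term n k a : (a < M n)%N -> exists s : nat,
  (M n)%:R * k.+1%:R * (a%:R ^+ k * rat_R (bern_dist p d c n a)) =
  a%:R ^+ k.+1 - (c * divc p d c n a)%N%:R ^+ k.+1 + (M n)%:R ^+ 2 * s%:R
  + (M n)%:R * k.+1%:R * kappa * a%:R ^+ k.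
Proof.
move=> aM; have [q qE] := divc_small p_pr d_gt0 cop_dc cop_cp aM.
have [s sE] : exists s, ((a + q * M n) ^ k.+1 =
    a ^ k.+1 + k.+1 * a ^ k * (q * M n) + (q * M n) ^ 2 * s)%N.
  elim: k {qE} => [|k [s sE]]; first by exists 0%N; rewrite !expn1 muln0; ring.
  exists (s * (a + q * M n) + k.+1 * a ^ k)%N.
  by rewrite expnS sE !expnS; ring.
exists (q ^ 2 * s)%N.
have cbE : (c * divc p d c n a)%N%:R ^+ k.+1 = a%:R ^+ k.+1 +
    k.+1%:R * a%:R ^+ k * (q%:R * (M n)%:R) + (q%:R * (M n)%:R) ^+ 2 * s%:R :> R.
  by rewrite qE -natrX sE !(natrD, natrM, natrX).
rewrite (bern_dist_quo p_pr d_gt0 aM qE) cbE [(q ^ 2 * s)%N%:R]natrM natrX.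
by rewrite rmorphD rmorphN /= ofrat_natr; ring.
Qed.

(** Division by c permutes the residues modulo M n, and e a = e c * e b when
    a is congruent to c * b. *)
Lemma sum_divc_powers n k : (f %| M n)%N -> (p %| M n)%N ->
  \sum_(a < M n) prime_to_p a * (c * divc p d c n a)%N%:R ^+ k =
  e c * c%:R ^+ k * power_sum_unit k (M n).
Proof.
move=> fM pM.
have M_gt0 := level_gt0 p_pr d_gt0 n.
pose s (a : 'I_(M n)) : 'I_(M n) := Ordinal (divc_lt p_pr c d_gt0 n a).
have s_inj : injective s.
  move=> a b /(congr1 val) /= ab.
  have := divcK p_pr d_gt0 cop_dc cop_cp n a.
  rewrite ab (divcK p_pr d_gt0 cop_dc cop_cp) !modn_small//.
  by move=> /val_inj.
rewrite /power_sum_unit mulr_sumr [RHS](reindex_inj s_inj) /=.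
apply: eq_bigr => a _; set b := divc _ _ _ _ _.
have cb : (c * b = a %[mod M n])%N by exact: divcK.
have modD N : (N %| M n)%N -> (c * b = a %[mod N])%N.
  by move=> NM; rewrite -(modn_dvdm (c * b) NM) cb modn_dvdm.
have -> : prime_to_p a = e c * prime_to_p b.
  rewrite /prime_to_p -(coprime_modl a) -(modD _ pM) coprime_modl coprimeMl cop_cp.
  by rewrite -(e_mod (modD _ fM)) eM /=; case: ifP => _; rewrite ?mulr0.
by rewrite natrM exprMn; ring.
Qed.

Lemma bern_sum_identity n k : (f %| M n)%N -> (p %| M n)%N ->
  exists s : nat -> nat,
  (M n)%:R * k.+1%:R *
    (\sum_(a < M n) prime_to_p a * a%:R ^+ k * rat_R (bern_dist p d c n a)) =
  (1 - e c * c%:R ^+ k.+1) * power_sum_unit k.+1 (M n)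
  + (M n)%:R ^+ 2 * (\sum_(a < M n) prime_to_p a * (s a)%:R)
  + (M n)%:R * k.+1%:R * kappa * power_sum_unit k (M n).
Proof.
move=> fM pM.
have /choice[s sE] : forall a : nat, exists s : nat, (a < M n)%N ->
  (M n)%:R * k.+1%:R * (a%:R ^+ k * rat_R (bern_dist p d c n a)) =
  a%:R ^+ k.+1 - (c * divc p d c n a)%N%:R ^+ k.+1 + (M n)%:R ^+ 2 * s%:R
  + (M n)%:R * k.+1%:R * kappa * a%:R ^+ k.
  move=> a; case: (boolP (a < M n)%N) => [/(bern_sum_term k)[s sE]|_].
    by exists s.
  by exists 0%N.
exists s; rewrite mulrBl mul1r -(sum_divc_powers _ fM pM) /power_sum_unit.
rewrite !mulr_sumr -sumrB -!big_split /=; apply: eq_bigr => a _.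
rewrite -[_ * _ * rat_R _]mulrA mulrCA sE//.
by ring.
Qed.

Lemma bounded_prime_to_p_sum (N : nat -> nat) (s : nat -> nat -> nat) :
  bounded_seq (fun i => \sum_(a < N i) prime_to_p a * (s i a)%:R).
Proof.
have [C eC] := bounded_character.
exists (C * nnorm (1 : R)) => i.
have C0 : 0 <= C by rewrite (le_trans _ (eC 0%N)) ?nnorm_ge0.
rewrite nnorm_sum_le ?mulr_ge0 ?nnorm_ge0// => a _.
rewrite nnormM_le_bound ?nnorm_natr// /prime_to_p.
by case: ifP => _; rewrite ?nnorm0.
Qed.

Lemma ofrat_mulV (k : nat) (x y : R) : (0 < k)%N -> k%:R * x = y ->
  x = rat_R k%:R^-1 * y.
Proof.
move=> k0 <-; rewrite mulrA -[in RHS](ofrat_natr k) -rmorphM /= mulVf.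
  by rewrite rmorph1 mul1r.
by rewrite pnatr_eq0 -lt0n.
Qed.

Lemma ofrat_mulI (k : nat) (x y : R) : (0 < k)%N -> k%:R * x = k%:R * y -> x = y.
Proof.
by move=> k0 xy; rewrite (ofrat_mulV k0 xy) -(ofrat_mulV k0 (erefl (k%:R * y))).
Qed.

Local Open Scope classical_set_scope.

(** For large n one has M n = p * h * f with h a multiple of a power of p.  In
    [bern_sum_identity] the power sums of exponent k.+1 contribute a term linear
    in h, which gives the limit; everything else is divisible by h ^ 2, and the
    factor M n on the left cancels only one h. *)
Lemma riemann_sum_cvg m k : (f %| M m)%N ->
  \sum_(a < M n) prime_to_p a * a%:R ^+ k * rat_R (bern_dist p d c n a)
    @[n --> \oo] -->
  rat_R k.+1%:R^-1 * ((1 - e c * c%:R ^+ k.+1) * (1 - e p * p%:R ^+ k) *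
    (f%:R ^+ k * bernoulli_sum k.+1)).
Proof.
move=> fm.
set u := fun n => \sum_(a < M n) _; set l := rat_R _ * _.
apply: (@cvg_shift _ _ _ _ _ _ m.+1).
have [v0 v0b v0E] := power_sum_expansion k.
have [v1 v1b v1E] := power_sum_expansion k.+1.
pose h0 := (M m %/ f)%N; pose h n := (h0 * p ^ n)%N.
have hE n : M (n + m.+1) = (p * (h n * f))%N.
  rewrite /h [(h0 * _ * f)%N]mulnAC divnK// addnS levelS [(n + m)%N]addnC.
  by rewrite expnD [(d * (_ * _))%N]mulnA.
have fM n : (f %| M (n + m.+1))%N by rewrite hE mulnA dvdn_mull.
have pM n : (p %| M (n + m.+1))%N by rewrite hE dvdn_mulr.
have /choice[s sE] := fun n => bern_sum_identity k (fM n) (pM n).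
have M_gt0 := level_gt0 p_pr d_gt0 m.
have h0_gt0 : (0 < h0)%N by rewrite divn_gt0// dvdn_leq.
have h_gt0 n : (0 < h n)%N by rewrite muln_gt0 h0_gt0 expn_gt0 p_gt0.
(* M (n + m.+1) * k.+1 = h n * D *)
pose D := (p * f * k.+1)%N.
have D_gt0 : (0 < D)%N by rewrite !muln_gt0 p_gt0 f_gt0.
(* The coefficients of h ^ 2 and of h in the sums of exponents k.+1 and k, then
   the coefficient of h ^ 2 in the whole identity. *)
pose W1 n := p%:R ^+ 2 * v1 (p * h n)%N - e p * p%:R ^+ k.+1 * v1 (h n).
pose W0 n := p%:R * (f%:R ^+ k * bernoulli_sum k)
  + p%:R ^+ 2 * (h n)%:R * v0 (p * h n)%N
  - e p * p%:R ^+ k * (f%:R ^+ k * bernoulli_sum k + (h n)%:R * v0 (h n)).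
pose S n := \sum_(a < M (n + m.+1)) prime_to_p a * (s n a)%:R.
pose V n := (1 - e c * c%:R ^+ k.+1) * W1 n + p%:R ^+ 2 * f%:R ^+ 2 * S n
  + p%:R * f%:R * k.+1%:R * kappa * W0 n.
apply: (@cvg_up_to_pX _ _ _ _ _ (fun n => h0%:R * rat_R D%:R^-1 * V n)).
  have cstb x : bounded_seq (fun=> x : R) by exact: bounded_seq_cst.
  have subb (N : nat -> nat) v : bounded_seq v -> bounded_seq (fun n => v (N n) : R).
    by move=> [C vC]; exists C => n; exact: vC.
  have hb : bounded_seq (fun n => (h n)%:R : R) by exact: bounded_seq_natr.
  have oppb x v : bounded_seq v -> bounded_seq (fun n => - (x * v n) : R).
    by move=> vb; under eq_fun => n do rewrite -mulNr; exact: bounded_seqM.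
  apply: bounded_seqM => //; apply: bounded_seqD; first apply: bounded_seqD.
  - apply: bounded_seqM => //; apply: bounded_seqD.
      by apply: bounded_seqM => //; exact: subb.
    by apply: oppb; exact: subb.
  - by apply: bounded_seqM => //; exact: bounded_prime_to_p_sum.
  - apply: bounded_seqM => //; apply: bounded_seqD; first apply: bounded_seqD => //.
      by apply: bounded_seqM; [exact: bounded_seqM|exact: subb].
    apply: oppb; apply: bounded_seqD => //.
    by apply: bounded_seqM => //; exact: subb.
move=> n.
have K_gt0 : (0 < M (n + m.+1) * k.+1)%N by rewrite muln_gt0 level_gt0.
apply: (ofrat_mulI K_gt0).
have Dinv : p%:R * f%:R * k.+1%:R * rat_R D%:R^-1 = 1.
  rewrite -!natrM -(ofrat_natr (p * f * k.+1)) -rmorphM divff ?rmorph1//.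
  by rewrite pnatr_eq0 -lt0n.
have kinv : k.+1%:R * rat_R k.+1%:R^-1 = 1.
  by rewrite -(ofrat_natr k.+1) -rmorphM divff ?rmorph1// pnatr_eq0.
have PE j : power_sum_unit j (M (n + m.+1)) =
    power_sum j (p * h n * f) - e p * p%:R ^+ j * power_sum j (h n * f).
  by rewrite hE power_sum_unitE mulnA.
have MR : (M (n + m.+1))%:R = p%:R * (h n)%:R * f%:R :> R by rewrite hE !natrM mulrA.
have hR : (h n)%:R = h0%:R * p%:R ^+ n :> R by rewrite natrM natrX.
rewrite [(M _ * _)%N%:R]natrM sE -/(S n) !PE !v0E !v1E MR.
have -> : p%:R * (h n)%:R * f%:R * k.+1%:R * (l + p%:R ^+ n * (h0%:R * rat_R D%:R^-1 * V n)) =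
    p%:R * (h n)%:R * f%:R * (k.+1%:R * rat_R k.+1%:R^-1) *
      ((1 - e c * c%:R ^+ k.+1) * (1 - e p * p%:R ^+ k) * (f%:R ^+ k * bernoulli_sum k.+1))
    + (h n)%:R * (p%:R * f%:R * k.+1%:R * rat_R D%:R^-1) * (h0%:R * p%:R ^+ n) * V n.
  by rewrite /l; ring.
rewrite kinv Dinv -hR /V /W1 /W0 [(p * h n)%N%:R]natrM !exprS.
by ring.
Qed.

End Riemann.

End TwistedPowerSums.

(** * Special values of the p-adic L-function *)

Section SpecialValues.
Variables (p : nat) (p_pr : prime p) (K : realType).
Variable R : completeNonArchAlgType K p_pr.
Notation Zp := (padicInt p_pr).

Let p_gt0 := prime_gt0 p_pr.

Lemma teichmuller1 : teichmuller p_pr 1%g = 1.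
Proof.
apply: (mulIr (teichmuller_unit p_pr 1%g)).
by rewrite -teichmullerM mulg1 mul1r.
Qed.

Lemma teich_inv_dirichlet j : is_dirichlet (teich_inv R j).
Proof.
split=> [|u v]; first by rewrite /teich_inv teichmuller1 invr1 expr1n rmorph1.
rewrite /teich_inv teichmullerM invrM ?teichmuller_unit//.
by rewrite exprMn rmorphM mulrC.
Qed.

Lemma angle_natr (a : nat) : angle (a%:R : Zp) = (teichmuller p_pr (toUnit p a))^-1 * a%:R.
Proof.
rewrite /angle /teichmuller_padic; congr ((teichmuller _ _)^-1 * _).
by apply: toUnit_mod => //; rewrite zmod_nat expn1 modn_mod.
Qed.

Lemma teich_inv_angle (a i j : nat) : teich_inv R i (toUnit p a) *
    ofZp R (angle (a%:R : Zp) ^+ j) = teich_inv R (i + j) (toUnit p a) * a%:R ^+ j.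
Proof.
rewrite angle_natr exprMn /teich_inv rmorphM mulrA -rmorphM /= -exprD.
congr (_ * _).
by rewrite (rmorphXn (ofZp R)) (rmorph_nat (ofZp R)).
Qed.

Lemma zmod_congrM (x y x' y' : Zp) n : zmod x n = zmod x' n ->
  zmod y n = zmod y' n -> zmod (x * y) n = zmod (x' * y') n.
Proof. by move=> xx yy; rewrite !zmodM xx yy. Qed.

Lemma zmod_angleX (x y : Zp) n j : (0 < n)%N -> zmod x n = zmod y n ->
  zmod (angle x ^+ j) n = zmod (angle y ^+ j) n.
Proof.
move=> n0 xy; elim: j => [//|j IH]; rewrite !exprS.
apply: zmod_congrM => //; apply: zmod_congrM => //.
by rewrite /teichmuller_padic -(zmod_small_level x n0) xy zmod_small_level.
Qed.

Section Integrand.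
Variables (d c m : nat).
Hypotheses (d_gt0 : (0 < d)%N) (cop_dc : coprime d c) (cop_dp : coprime d p).
Hypotheses (cop_cp : coprime c p) (m_gt0 : (0 < m)%N).
Notation N := (d * p ^ m)%N.
Notation X := (weightDomain p_pr d).
Variable chi : {unit 'Z_N} -> R.
Hypothesis chiD : is_dirichlet chi.
Hypothesis d_cond : (d %| conductor chi)%N.

Let N_gt0 : (0 < N)%N. Proof. exact: level_gt0. Qed.
Let cop_dpm : coprime d (p ^ m). Proof. by rewrite coprimeXr. Qed.
Let coprimeN a : coprime a N = coprime a p && coprime a d.
Proof. by rewrite coprimeMr coprime_pexpr// andbC. Qed.

(** The function integrated in [padicL]. *)
Definition integrand (k : nat) (a : X) : R :=
  inflate N (dir_mul chi (teich_inv R 1)) (crt_unit m a) * weight R k a.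

Lemma crt_unit_nat (a : nat) (u : padicUnit p_pr) : coprime a d ->
  val u = a%:R -> crt_unit m ((toUnit d a, u) : X) = toUnit N a.
Proof.
move=> ad ua; apply: toUnit_mod => //; apply/eqP.
rewrite chinese_remainder// chinese_modl// chinese_modr//= ua zmod_nat modn_mod eqxx andbT.
have [d1|d1] := leqP d 1; last by rewrite val_toUnit// modn_mod.
have /eqP -> : d == 1%N by rewrite eqn_leq d1.
by rewrite !modn1.
Qed.

Lemma integrand_nat k (a : nat) (u : padicUnit p_pr) : coprime a N ->
  val u = a%:R -> integrand k (toUnit d a, u) =
  chi (toUnit N a) * teich_inv R k.+1 (toUnit p a) * a%:R ^+ k.
Proof.
move=> aN ua; have /andP[ap ad] : coprime a p && coprime a d by rewrite -coprimeN.
rewrite /integrand crt_unit_nat// /inflate /= unitRed_toUnit//; last first.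
  exact: twist_conductor_dvd.
rewrite (dir_mul_toUnit p_pr)// /weight /= ua -mulrA teich_inv_angle.
by rewrite add1n mulrA.
Qed.

(** The character factor takes finitely many values, and [angle x] modulo p ^ n
    depends on x modulo p ^ n. *)
Lemma integrand_continuous k : continuous (integrand k).
Proof.
apply: oscillation_continuous => eps eps0.
pose A u := inflate N (dir_mul chi (teich_inv R 1)) u.
pose C := \big[Num.max/0]_(u : {unit 'Z_N}) nnorm (A u).
have AC u : nnorm (A u) <= C by exact: le_bigmax.
have C0 : 0 <= C by rewrite (le_trans _ (AC 1%g))// nnorm_ge0.
have C10 : 0 <= C * nnorm (1 : R) by rewrite mulr_ge0// nnorm_ge0.
have [n0 n0P] := rho_small p_pr C10 eps0.
exists (n0 + m)%N => x y xy.
have n0m : (0 < n0 + m)%N by rewrite addn_gt0 m_gt0 orbT.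
have -> : integrand k x - integrand k y = A (crt_unit m x) *
    (ofZp R (angle (val x.2) ^+ k) - ofZp R (angle (val y.2) ^+ k)).
  rewrite mulrBr /integrand /weight -/(A _) -/(A _); congr (_ - A _ * _).
  have [x1 x2] := same_cyl_le (leq_addl n0 m) xy.
  by rewrite /crt_unit x1 x2.
rewrite (le_trans (nnormM_le_bound C0 (AC _) (padic_close _ (zmod_angleX k n0m xy.2))))//.
by rewrite mulrCA ltW// n0P// leq_addr.
Qed.

Lemma bern_sum_integrand k n : (0 < n)%N ->
  bern_sum c (integrand k) n = \sum_(a < d * p ^ n)
    prime_to_p (fun a : nat => dir_eval (dir_mul chi (teich_inv R k.+1)) a) a
      * a%:R ^+ k * ofrat R (bern_dist p d c n a).
Proof.
move=> n0; apply: eq_bigr => a _; congr (_ * _).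
have dvd_d := dvdn_twist_conductor p_pr d_gt0 cop_dp m_gt0 chiD
  (teich_inv_dirichlet k.+1) d_cond.
rewrite /prime_to_p; case: (boolP (coprime a p)) => [ap|ap]; last first.
  by rewrite mul0r ext0_eq0// (negbTE ap).
case: (boolP (coprime a d)) => [ad|ad]; last first.
  rewrite dir_eval_eq0 ?mul0r ?ext0_eq0// ?(negbTE ad) ?andbF//.
  by apply: contra ad; exact: coprime_dvdr.
have aN : coprime a N by rewrite coprimeN ap.
have [u ua ->] := ext0_coprime (integrand k) ap ad.
rewrite integrand_nat// dir_eval_coprime ?dir_mul_toUnit//.
by apply: coprime_dvdr aN; exact: twist_conductor_dvd.
Qed.

End Integrand.

(** The term a = f replaces a = 0 in the definition of the generalized
    Bernoulli numbers; for index at least 2 they are equal. *)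
Lemma gen_bernoulliE L (psi : {unit 'Z_L} -> R) k : (0 < L)%N -> (0 < k)%N ->
  gen_bernoulli k.+1 (primitive psi) =
  (conductor psi)%:R ^+ k * bernoulli_sum
     (fun a : nat => dir_eval (primitive psi) a) (conductor psi) k.+1.
Proof.
move=> L0 k0; rewrite /gen_bernoulli /=.
under eq_bigr => a _ do rewrite dir_eval_primitive2//.
rewrite conductor_primitive//; set f := conductor psi.
have f0 : (0 < f)%N by exact: conductor_gt0.
have -> : (k.+1%:Z - 1)%R = k%:Z by rewrite -addn1 PoszD addrK.
rewrite -exprnP rmorphXn rmorph_nat; congr (_ * _).
pose G a := dir_eval (primitive psi) a%:Z * ofrat R (bern_poly k.+1).[a%:R / f%:R].
have G0f : G f = G 0%N.
  rewrite /G (@dir_eval_mod _ _ f0 _ f 0%N) ?modnn ?mod0n//; congr (_ * ofrat R _).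
  rewrite mul0r divff ?pnatr_eq0 -?lt0n//.
  apply/eqP; rewrite -subr_eq0; have := bern_poly_diff k.+1 0.
  by rewrite add0r => ->; rewrite /= expr0n (gtn_eqF k0) mulr0.
have e1 : \sum_(0 <= a < f.+1) G a = \sum_(0 <= a < f) G a + G 0%N.
  by rewrite big_nat_recr//= G0f.
rewrite big_ltn// addrC in e1; move/addIr: e1 => e1.
by rewrite [LHS]e1 big_mkord.
Qed.

End SpecialValues.

Theorem mainTheorem1 (p : nat) (p_pr : prime p) (p_odd : odd p)
    (d c : nat) (d_gt0 : (0 < d)%N) (c_gt0 : (0 < c)%N)
    (cop_dc : coprime d c) (cop_dp : coprime d p) (cop_cp : coprime c p)
    (K : realType) (R : completeNonArchAlgType K p_pr)
    (R_domain : forall x y : R, x * y = 0 -> x = 0 \/ y = 0)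
    (m : nat) (m_gt0 : (0 < m)%N)
    (chi : {unit 'Z_(d * p ^ m)} -> R)
    (chi_dirichlet : is_dirichlet chi)
    (chi_even : dir_eval chi (- 1) = 1)
    (d_dvd_cond : (d %| conductor chi)%N)
    (n : nat) (n_gt1 : (1 < n)%N) :
  let chi_n := dir_mul chi (teich_inv R n) in
  padicL c (weight R (n - 1)) chi =
    ofQp R (n%:R^-1)
    * (1 - dir_eval chi c%:Z * ofZp R (angle (c%:R : padicInt p_pr) ^+ n))
    * (1 - dir_eval chi_n p%:Z * p%:R ^+ (n - 1))
    * gen_bernoulli n chi_n.
Proof.
move=> chi_n.
case: n n_gt1 @chi_n => [//|k]; rewrite ltnS => k0 chi_n; rewrite subn1 /=.
have p_gt0 := prime_gt0 p_pr.
pose psi := dir_mul_lcm chi (teich_inv R k.+1).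
have L_gt0 : (0 < lcmn (d * p ^ m) p)%N.
  by rewrite lcmn_gt0 p_gt0 level_gt0.
have f_gt0 : (0 < conductor psi)%N by exact: conductor_gt0.
have f_dvd : (conductor psi %| d * p ^ m)%N by exact: twist_conductor_dvd.
have cN : coprime c (d * p ^ m) by exact: coprime_c_level.
rewrite /padicL -/(integrand chi k).
rewrite (bern_integral_lim d_gt0 cop_dc cop_cp); last exact: integrand_continuous.
have -> : ofQp R k.+1%:R^-1 = ofrat R k.+1%:R^-1.
  rewrite -[RHS]mulr1; apply: ofrat_mulV => //.
  rewrite -(rmorph_nat (ofQp R)) -rmorphM divff ?rmorph1//.
  by rewrite padic_natr_neq0.
have -> : dir_eval chi c * ofZp R (angle (c%:R : padicInt p_pr) ^+ k.+1) =
    dir_eval chi_n c * c%:R ^+ k.+1.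
  rewrite !dir_eval_coprime//; last exact: coprime_dvdr f_dvd cN.
  rewrite /chi_n (dir_mul_toUnit p_pr)// -[RHS]mulrA; congr (_ * _).
  rewrite -[ofZp _ _]mul1r; have := teich_inv_angle R c 0 k.+1.
  by rewrite add0n {1}/teich_inv expr0 rmorph1.
rewrite [gen_bernoulli _ _]gen_bernoulliE// -!mulrA.
rewrite /bern_locconst; apply: nnorm_lim.
pose e a := dir_eval chi_n (Posz a).
have e_mod a b : a = b %[mod conductor psi] -> e a = e b by exact: dir_eval_mod.
have eM a b : e (a * b)%N = e a * e b.
  exact: (dir_mul_evalM p_pr d_gt0 cop_dp m_gt0 chi_dirichlet
    (teich_inv_dirichlet R k.+1) d_dvd_cond).
have := riemann_sum_cvg f_gt0 e_mod eM d_gt0 cop_dc cop_cp (k := k) f_dvd.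
rewrite -!mulrA => /nnorm_cvgP Hcvg; apply/nnorm_cvgP => eps /Hcvg[n0 h].
exists n0.+1 => n n0n; have n_gt0 : (0 < n)%N by exact: leq_trans n0n.
by rewrite bern_sum_integrand//; exact/h/ltnW.
Qed.
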